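(* Let $N\geq1$ be an integer and let $f_0,f_1$ be smooth vector fields on $\mathbb{R}^d$ such that $f_{W_j}=0$ for $j=1,\dots,N-1$. If there exists an $(\mathbb{R}^+,\mathbb{R})$ splitting method of order $2N+1$ relative to $(f_0,f_1)$, then the vector fields $f_{M_{2N}}$ and $f_{W_N}$ are linearly dependent (over $\mathbb{R}$).
   Context: $\mathbb{R}^+=[0,\infty)$. The Lie bracket of smooth vector fields is $[f,g](x)=Dg(x)f(x)-Df(x)g(x)$. Define vector fields by $f_{M_0}=f_1$, and for $j\geq1$, $f_{M_j}=[f_{M_{j-1}},f_0]$ and $f_{W_j}=[f_{M_{j-1}},f_{M_j}]$. For a vector field $g$, $e^{g}$ denotes the time-one flow of $\dot x=g(x)$; products of flows are compositions of maps (rightmost applied first). An $(\mathbb{R}^+,\mathbb{R})$ splitting method consists of $k\geq1$, $(\alpha_1,\dots,\alpha_k)\in(\mathbb{R}^+)^k$ and $(\beta_1,\dots,\beta_k)\in\mathbb{R}^k$, independent of $T$. It is of order $n$ relative to $(f_0,f_1)$ when, for every $x_0\in\mathbb{R}^d$, there exists $C$ such that, for $T>0$ small enough, $$\left| e^{T(f_0+f_1)}x_0 - e^{\alpha_1 T f_0}e^{\beta_1 T f_1}\cdots e^{\alpha_k T f_0}e^{\beta_k T f_1}x_0\right|\leq C\,T^{n+1}.$$ *)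

(* Defs.v *)
From mathcomp Require Import all_boot all_order all_algebra.
From mathcomp Require Import all_classical all_reals all_analysis.

Set Implicit Arguments.
Unset Strict Implicit.
Unset Printing Implicit Defensive.

Import Order.TTheory GRing.Theory Num.Theory.
Import numFieldNormedType.Exports.
Local Open Scope classical_set_scope.
Local Open Scope ring_scope.

Section VectorFields.
Context {R : realType} {d : nat}.
Local Notation V := 'rV[R]_d.
Implicit Types (f g : V -> V) (x y : V).

(* As d is finite, [x |-> Df(x)] is of class C^n iff [x |-> Df(x) v] is for
   every fixed vector v. *)
Fixpoint class_C (n : nat) f : Prop :=
  match n with
  | 0 => continuous f
  | m.+1 => (forall x, differentiable f x) /\
            (forall v, class_C m (fun x => 'd f x v))
  end.

Definition smooth f : Prop := forall n, class_C n f.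

Definition lie_bracket f g : V -> V := fun x => 'd g x (f x) - 'd f x (g x).

Fixpoint fM f0 f1 (j : nat) : V -> V :=
  match j with
  | 0 => f1
  | i.+1 => lie_bracket (fM f0 f1 i) f0
  end.

(* Meaningful for 1 <= j only. *)
Definition fW f0 f1 (j : nat) : V -> V :=
  lie_bracket (fM f0 f1 j.-1) (fM f0 f1 j).

(* [exp_flow g x y] means that e^g x is defined and equal to y. This is a
   relation because g need not be complete. Asking for a two-sided derivative
   at the endpoints 0 and 1 is harmless, since a solution on [0, 1] extends
   affinely to the whole line. *)
Definition exp_flow g x y : Prop :=
  exists phi : R -> V,
    [/\ phi 0 = x,
        forall t : R, 0 <= t <= 1 -> is_derive t (1 : R) phi (g (phi t))
      & phi 1 = y].

(* [split_flow f0 f1 T [:: (a1, b1); ...; (ak, bk)] x y] means that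
   e^{a1 T f0} e^{b1 T f1} ... e^{ak T f0} e^{bk T f1} x is defined and equal
   to y; the factor e^{bk T f1} acts first. *)
Fixpoint split_flow f0 f1 (T : R) (ab : seq (R * R)) x y : Prop :=
  match ab with
  | [::] => y = x
  | (a, b) :: ab' => exists u v,
      [/\ split_flow f0 f1 T ab' x u,
          exp_flow ((b * T) \*: f1) u v
        & exp_flow ((a * T) \*: f0) v y]
  end.

(* The norm is the sup norm of 'rV_d; the choice of norm on R^d only affects
   the constant C. *)
Definition has_order f0 f1 (ab : seq (R * R)) (n : nat) : Prop :=
  forall x0, exists C : R, \forall T \near (0 : R)^'+,
    exists y z,
      [/\ exp_flow (T \*: (f0 \+ f1)) x0 y,
          split_flow f0 f1 T ab x0 z
        & `|y - z| <= C * T ^+ n.+1].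

Definition exists_splitting_method_of_order f0 f1 (n : nat) : Prop :=
  exists (k : nat) (alpha beta : k.-tuple R),
    [/\ (1 <= k)%N,
        forall i, 0 <= tnth alpha i
      & has_order f0 f1 (zip alpha beta) n].

Definition linearly_dependent2 f g : Prop :=
  exists a b : R, (a, b) <> (0, 0) /\ forall x, a *: f x + b *: g x = 0.

End VectorFields.

(* Main.v *)
Require Import Defs.
From HB Require Import structures.
From mathcomp Require Import all_boot all_order all_algebra.
From mathcomp Require Import all_classical all_reals all_analysis.
From mathcomp Require Import ring lra zify.

Set Implicit Arguments.
Unset Strict Implicit.
Unset Printing Implicit Defensive.

Import Order.TTheory GRing.Theory Num.Theory.
Import numFieldNormedType.Exports.
Local Open Scope classical_set_scope.
Local Open Scope ring_scope.

(** Write X = T L_{f0} and Y = T L_{f1}, where L_f h = Dh.f is the Lie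
    derivative acting on smooth functions.  Taylor expansion along flows says
    that h (e^{T f} x) has the T-expansion of (exp (T L_f) h) (x), so a
    splitting method of order 2N+1 gives, modulo T^{2N+2} and on coordinate
    functions, an identity between the product of the operators
    exp (beta_i Y) exp (alpha_i X), in the reverse order of the flows, and
    exp (X + Y) ([order_condition]).

    Put M_j = T^{j+1} L_{f_{M_j}} and W = T^{2N+1} L_{f_{W_N}}; as f |-> L_f
    is a Lie morphism ([lieD_bracket]), M_{j+1} = [M_j, X] and
    W = [M_{N-1}, M_N].  The vanishing of W_1, ..., W_{N-1} and the Jacobi
    identity make all the [M_i, M_j] vanish when i + j <= 2N - 2, and reduce
    them to multiples of W when i + j = 2N - 1 ([iter_commE]); W is of top
    order.  Modulo T^{2N+2} the M_j thus generate a Heisenberg algebra.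
    Moving all the factors exp (alpha_i X) to the left turns the i-th kick
    exp (beta_i Y) into the exponential of beta_i sum_j t_i^j/j! M_j with
    t_i = alpha_1 + ... + alpha_i, and the Heisenberg relation
    e^z e^z' = e^{z+z'} + [z, z']/2 collects the kicks ([kick_prodE]):

      product  = e^{sigma X} (exp (sum_j m_j M_j) + A W),
      e^{X+Y}  = e^X (exp (sum_j M_j / (j+1)!) + A_1 W),

    where sigma is the sum of the alpha_i, m_j = sum_i beta_i t_i^j/j!, and A
    is a quadratic form in the beta_i ([split_opE], [exp_sum]).

    Suppose that f_{M_{2N}} and f_{W_N} are independent.  Then no f_{M_j} with
    j <= 2N vanishes, and comparing orders of T one after the other gives
    sigma = 1, m_j = 1/(j+1)! for all j <= 2N, and A = A_1
    ([splitting_obstruction]).  In other words the signed measure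
    w = sum_i beta_i delta_{t_i} - dt on [0, 1] has zero moments up to order
    2N and a zero quadratic form.  But for measures with vanishing moments
    this form is, up to sign, the integral of the square of the N-fold
    primitive of w, because the alpha_i >= 0 make the kicks ordered in time;
    so w = 0, which is absurd as a finite sum of Dirac masses is not the
    Lebesgue measure ([no_positive_quadrature]). *)

(** * Exponentials in a nilpotent filtered algebra *)

Lemma sum_triangle (V : nmodType) (n : nat) (f : nat -> nat -> V) :
  (forall i j, (n < i + j)%N -> f i j = 0) ->
  \sum_(k < n.+1) \sum_(i < k.+1) f i (k - i)%N =
  \sum_(i < n.+1) \sum_(j < n.+1) f i j.
Proof.
move=> f0.
rewrite (eq_bigr (fun k : 'I_n.+1 =>
  \sum_(i < n.+1 | (i <= k)%N) f i (k - i)%N)); last first.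
  move=> k _; rewrite (big_ord_widen n.+1 (fun i => f i (k - i)%N)) //.
rewrite (exchange_big_dep xpredT) //=; apply: eq_bigr => i _.
rewrite -(big_mkord (fun k => (i <= k)%N) (fun k => f i (k - i)%N)).
rewrite (@big_cat_nat _ _ _ i) ?(ltnW (ltn_ord i)) //=.
rewrite big_nat_cond big_pred0 ?add0r; last first.
  by move=> k; case: ltnP => //=; case: leqP => //=; rewrite ?andbF //; lia.
rewrite -{1}(add0n (i : nat)) big_addn big_mkcond /=.
rewrite -(big_mkord xpredT (f i)) [RHS](@big_cat_nat _ _ _ (n.+1 - i)) ?leq_subr //=.
rewrite [X in _ = _ + X]big_nat_cond [X in _ = _ + X]big1 ?addr0; last first.
  by move=> j; rewrite andbT => /andP[h _]; apply: f0; lia.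
by apply: eq_big_nat => j _; rewrite leq_addl addnK.
Qed.

Section NilpotentExponential.
Context {R : numFieldType} {B : algType R}.
Implicit Types x y : B.

Definition comm x y := x * y - y * x.
Definition dpow k x : B := (k`!%:R)^-1 *: x ^+ k.
(** In an algebra whose elements of order > n vanish, this is the exponential
    of every element of positive order. *)
Definition nexp n x := \sum_(k < n.+1) dpow k x.

(** F k x reads: x is of order at least k.  Elements of order > n are
    zero, which models computations modulo T^{n+1}. *)
Record filtered n (F : nat -> B -> Prop) : Prop := Filtered {
  filD : forall k x y, F k x -> F k y -> F k (x + y);
  filZ : forall k a x, F k x -> F k (a *: x);
  filM : forall i j x y, F i x -> F j y -> F (i + j)%N (x * y);
  fil_le : forall i j x, (i <= j)%N -> F j x -> F i x;
  fil0 : forall k, F k 0;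
  fil1 : F 0%N 1;
  fil_top : forall x, F n.+1 x -> x = 0
}.

Lemma dpow0 x : dpow 0 x = 1.
Proof. by rewrite /dpow fact0 invr1 scale1r. Qed.

Lemma dpow1 x : dpow 1 x = x.
Proof. by rewrite /dpow invr1 scale1r. Qed.

Lemma factS_neq0 k : (k.+1%:R : R) != 0 /\ (k`!%:R : R) != 0.
Proof. by rewrite !pnatr_eq0 -!lt0n fact_gt0. Qed.

Lemma factSV k : ((k.+1)`!%:R : R)^-1 = k.+1%:R^-1 * k`!%:R^-1.
Proof. by rewrite factS natrM invfM mulrC. Qed.

Lemma dpowS x k : x * dpow k x = k.+1%:R *: dpow k.+1 x.
Proof.
by rewrite /dpow -scalerAr -exprS scalerA factSV mulrA divff ?mul1r //;
  case: (factS_neq0 k).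
Qed.

Lemma dpowZ a x k : dpow k (a *: x) = a ^+ k *: dpow k x.
Proof. by rewrite /dpow exprZn !scalerA mulrC. Qed.

Lemma dpow_conj g g' x k : g' * g = 1 -> g * g' = 1 ->
  g' * dpow k x * g = dpow k (g' * x * g).
Proof.
move=> gg gg'; rewrite /dpow -scalerAr -scalerAl; congr (_ *: _).
elim: k => [|k IH]; first by rewrite !expr0 mulr1.
by rewrite !exprS -IH -[LHS]mulr1 -gg -!mulrA; congr (_ * (_ * _));
   rewrite !mulrA gg' mul1r -!mulrA gg mulr1.
Qed.

Section Filtered.
Variables (n : nat) (F : nat -> B -> Prop) (hF : filtered n F).

Lemma filN k x : F k x -> F k (- x).
Proof. by rewrite -scaleN1r; exact: (filZ hF). Qed.

Lemma filB k x y : F k x -> F k y -> F k (x - y).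
Proof. by move=> Fx Fy; apply: (filD hF) => //; apply: filN. Qed.

Lemma fil_sum k (I : Type) (r : seq I) (P : pred I) (f : I -> B) :
  (forall i, P i -> F k (f i)) -> F k (\sum_(i <- r | P i) f i).
Proof. by move=> Ff; apply: (big_ind (F k)) => //; [exact: (fil0 hF) | exact: (filD hF)]. Qed.

Lemma fil_gt k x : (n < k)%N -> F k x -> x = 0.
Proof. by move=> nk Fx; apply: (fil_top hF); exact: (fil_le hF nk Fx). Qed.

Lemma filX k x : F 1 x -> F k (x ^+ k).
Proof.
move=> Fx; elim: k => [|k IH]; first exact: (fil1 hF).
by rewrite exprS -add1n; apply: (filM hF).
Qed.

Lemma fil_dpow k x : F 1 x -> F k (dpow k x).
Proof. by move=> Fx; apply: (filZ hF); apply: filX. Qed.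

Lemma fil_nexpB1 x j : F j.+1 x -> F j.+1 (nexp n x - 1).
Proof.
move=> Fx; rewrite /nexp big_ord_recl dpow0 addrC addKr.
apply: fil_sum => i _; rewrite /= /dpow exprS; apply: (filZ hF).
rewrite -[j.+1]addn0; apply: (filM hF) => //.
have {}Fx : F 1 x by exact: (fil_le hF _ Fx).
by exact: (fil_le hF _ (filX i Fx)).
Qed.

Lemma fil_nexp x : F 1 x -> F 0 (nexp n x).
Proof.
move=> Fx; rewrite -[nexp _ _](subrK 1); apply: (filD hF); last exact: (fil1 hF).
by exact: (fil_le hF _ (fil_nexpB1 Fx)).
Qed.

(** The remainder starts with x^2. *)
Lemma nexp_remainder x j : F j.+1 x -> F (j + j).+2 (nexp n x - 1 - x).
Proof.
move=> Fx; case: (posnP n) => [n0|n0].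
  have -> : x = 0 by apply: (fil_gt _ Fx); rewrite n0.
  rewrite subr0 /nexp n0 big_ord1 dpow0 subrr; exact: (fil0 hF).
rewrite /nexp -[n]prednK // big_ord_recl big_ord_recl dpow0 dpow1 /=.
rewrite [1 + _]addrC addrK addrC addKr; apply: fil_sum => i _.
rewrite /dpow !exprS; apply: (filZ hF).
rewrite -addnS -addSn mulrA -[(_ + _)%N]addn0; apply: (filM hF).
  exact: (filM hF).
have {}Fx : F 1 x by exact: (fil_le hF _ Fx).
by exact: (fil_le hF _ (filX i Fx)).
Qed.

Lemma nexp0 : nexp n 0 = 1.
Proof.
rewrite /nexp big_ord_recl dpow0 big1 ?addr0 // => i _.
by rewrite /dpow expr0n scaler0.
Qed.

Lemma nexp_conj g g' x : g' * g = 1 -> g * g' = 1 ->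
  g' * nexp n x * g = nexp n (g' * x * g).
Proof.
move=> gg gg'; rewrite /nexp mulr_sumr mulr_suml.
by apply: eq_bigr => k _; rewrite dpow_conj.
Qed.

Section QuasiCommuting.
Variables (x y : B).
Hypotheses (Fx : F 1 x) (Fy : F 1 y) (Fc : F n (comm x y)).

Let mulc z : F 1 z -> z * comm x y = 0 /\ comm x y * z = 0.
Proof.
by move=> Fz; split; apply: (@fil_gt n.+1) => //;
  [rewrite -add1n | rewrite -addn1]; apply: (filM hF).
Qed.

Let comm_dpow i : y * dpow i x = dpow i x * y - (if i == 1%N then comm x y else 0).
Proof.
have cxy : y * x = x * y - comm x y by rewrite /comm opprB addrC subrK.
case: i => [|[|i]] /=; first by rewrite dpow0 mulr1 mul1r subr0.
  by rewrite dpow1.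
rewrite subr0 /dpow -scalerAr -scalerAl; congr (_ *: _).
elim: i => [|i IH].
  rewrite !expr2 mulrA cxy mulrBl (mulc Fx).2 subr0 -!mulrA cxy mulrBr.
  by rewrite (mulc Fx).1 subr0.
have xc : x ^+ i.+2 * comm x y = 0 by rewrite exprSr -mulrA (mulc Fx).1 mulr0.
rewrite exprSr mulrA IH -[x ^+ _ * y * x]mulrA cxy mulrBr xc subr0.
by rewrite mulrA.
Qed.

(** A commutator of top order is killed by every further factor, so x and y
    commute in all words of length at least 3, and the binomial formula only
    fails in degree 2, where y x = x y - [x, y]. *)
Lemma dpowD_quasi k :
  dpow k (x + y) = \sum_(i < k.+1) dpow i x * dpow (k - i) y
    - (if k == 2 then 2^-1 *: comm x y else 0).
Proof.
pose S k := \sum_(i < k.+1) dpow i x * dpow (k - i) y.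
have SE k' : S k' = \sum_(i < k'.+1) dpow (k' - i) x * dpow i y.
  rewrite /S (reindex_inj rev_ord_inj) /=; apply: eq_bigr => i _.
  by rewrite subSS subKn // -ltnS.
(* The binomial sums satisfy the recursion of the powers of x + y, up to the
   defect produced when y first crosses a single x. *)
have Srec k' : (x + y) * S k' =
    k'.+1%:R *: S k'.+1 - (if k' == 1%N then comm x y else 0).
  have xS : x * S k' = \sum_(i < k'.+2) i%:R *: (dpow i x * dpow (k'.+1 - i) y).
    rewrite big_ord_recl scale0r add0r mulr_sumr; apply: eq_bigr => i _.
    by rewrite mulrA dpowS scalerAl lift0 subSS.
  have yS : y * S k' = \sum_(i < k'.+2) i%:R *: (dpow (k'.+1 - i) x * dpow i y)
              - (if k' == 1%N then comm x y else 0).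
    rewrite big_ord_recl scale0r add0r.
    have -> : \sum_(i < k'.+1) (lift ord0 i : 'I_k'.+2)%:R *:
        (dpow (k'.+1 - lift ord0 i) x * dpow (lift ord0 i : 'I_k'.+2) y) =
        \sum_(i < k'.+1) dpow (k' - i) x * (y * dpow i y).
      by apply: eq_bigr => i _; rewrite lift0 subSS dpowS scalerAr.
    rewrite SE mulr_sumr.
    have -> : (if k' == 1%N then comm x y else 0) =
        \sum_(i < k'.+1) (if (k' - i == 1)%N then comm x y else 0) * dpow i y.
      case: (k') => [|[|l]] /=; first by rewrite big_ord1 mul0r.
        by rewrite big_ord_recl big_ord1 /= dpow0 mulr1 mul0r addr0.
      rewrite big1 // => i _; case: ifP => [hi|]; last by rewrite mul0r.
      have : (0 < i)%N by case: i hi => -[].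
      case: (nat_of_ord i) => // j _; rewrite /dpow exprS -scalerAr mulrA.
      by rewrite (mulc Fy).2 mul0r scaler0.
    by rewrite -sumrB; apply: eq_bigr => i _; rewrite mulrA comm_dpow mulrBl mulrA.
  rewrite mulrDl xS yS addrA; congr (_ - _).
  have -> : \sum_(i < k'.+2) i%:R *: (dpow (k'.+1 - i) x * dpow i y) =
            \sum_(i < k'.+2) (k'.+1 - i)%:R *: (dpow i x * dpow (k'.+1 - i) y).
    rewrite (reindex_inj rev_ord_inj) /=; apply: eq_bigr => i _.
    by rewrite subSS subKn // -ltnS.
  rewrite -big_split scaler_sumr; apply: eq_bigr => i _ /=.
  by rewrite -scalerDl -natrD subnKC // -ltnS.
elim: k => [|k IH].
  by rewrite /= subr0 big_ord1 !dpow0 mulr1.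
have k0 := (factS_neq0 k).1.
apply: (scalerI k0); rewrite -dpowS IH -/(S k) mulrBr Srec [RHS]scalerBr -/(S k.+1).
rewrite -addrA -opprD; congr (_ - _).
case: k {IH} k0 => [|[|[|k]]] _ /=.
- by rewrite mulr0 scaler0 addr0.
- by rewrite mulr0 addr0 scalerA divff ?scale1r // pnatr_eq0.
- by rewrite -scalerAr mulrDl (mulc Fx).1 (mulc Fy).1 !(addr0,scaler0).
- by rewrite mulr0 scaler0 addr0.
Qed.

(** The Baker-Campbell-Hausdorff formula e^x e^y = e^{x + y + [x, y]/2},
    where the central term leaves the exponential because its products with
    elements of positive order vanish. *)
Lemma nexpD_quasi : (1 < n)%N ->
  nexp n x * nexp n y = nexp n (x + y) + 2^-1 *: comm x y.
Proof.
move=> n1; rewrite [nexp n (x + y)]/nexp (eq_bigr _ (fun (k : 'I_n.+1) _ => dpowD_quasi k)).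
rewrite sumrB (@sum_triangle _ n (fun i j => dpow i x * dpow j y)); last first.
  move=> i j nij; apply: (fil_gt nij); apply: (filM hF); exact: fil_dpow.
have -> : \sum_(i < n.+1) (if i == 2 :> nat then 2^-1 *: comm x y else 0) = 2^-1 *: comm x y.
  rewrite -big_mkcond (big_pred1 (inord 2)) // => i /=.
  by rewrite -val_eqE /= inordK.
rewrite subrK /nexp mulr_suml; apply: eq_bigr => i _.
by rewrite mulr_sumr.
Qed.

End QuasiCommuting.

Lemma nexpD x y : (1 < n)%N -> F 1 x -> F 1 y -> x * y = y * x ->
  nexp n (x + y) = nexp n x * nexp n y.
Proof.
move=> n1 Fx Fy xy; have c0 : comm x y = 0 by rewrite /comm xy subrr.
by rewrite nexpD_quasi ?c0 ?scaler0 ?addr0 //; exact: (fil0 hF).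
Qed.

Lemma nexpN x : (1 < n)%N -> F 1 x -> nexp n (- x) * nexp n x = 1.
Proof.
move=> n1 Fx; rewrite -nexpD ?addNr ?nexp0 ?mulNr ?mulrN //.
exact: filN.
Qed.

Lemma nexpNr x : (1 < n)%N -> F 1 x -> nexp n x * nexp n (- x) = 1.
Proof. by move=> n1 Fx; rewrite -{1}(opprK x) nexpN //; apply: filN. Qed.

End Filtered.
End NilpotentExponential.

(** * Iterated commutators and the Heisenberg relation *)

Section CommutatorCalculus.
Context {R : numFieldType} {B : algType R}.
Implicit Types x y z : B.

Lemma commDl x y z : comm (x + y) z = comm x z + comm y z.
Proof. by rewrite /comm mulrDl mulrDr opprD addrACA. Qed.

Lemma commDr x y z : comm x (y + z) = comm x y + comm x z.
Proof. by rewrite /comm mulrDl mulrDr opprD addrACA. Qed.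

Lemma commZl a x y : comm (a *: x) y = a *: comm x y.
Proof. by rewrite /comm -scalerAl -scalerAr scalerBr. Qed.

Lemma commZr a x y : comm x (a *: y) = a *: comm x y.
Proof. by rewrite /comm -scalerAl -scalerAr scalerBr. Qed.

Lemma comm_suml (I : Type) (r : seq I) (P : pred I) (f : I -> B) y :
  comm (\sum_(i <- r | P i) f i) y = \sum_(i <- r | P i) comm (f i) y.
Proof. by rewrite /comm mulr_suml mulr_sumr -sumrB. Qed.

Lemma comm_sumr (I : Type) (r : seq I) (P : pred I) (f : I -> B) y :
  comm y (\sum_(i <- r | P i) f i) = \sum_(i <- r | P i) comm y (f i).
Proof. by rewrite /comm mulr_suml mulr_sumr -sumrB. Qed.

Lemma commxx x : comm x x = 0.
Proof. by rewrite /comm subrr. Qed.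

Lemma comm_anti x y : comm x y = - comm y x.
Proof. by rewrite /comm opprB. Qed.

Lemma commMl x y z : comm (x * y) z = x * comm y z + comm x z * y.
Proof. by rewrite /comm mulrBr mulrBl !mulrA addrA subrK. Qed.

Lemma commMr x y z : comm x (y * z) = comm x y * z + y * comm x z.
Proof. by rewrite /comm mulrBr mulrBl !mulrA addrA subrK. Qed.

Lemma commNl x y : comm (- x) y = - comm x y.
Proof. by rewrite -scaleN1r commZl scaleN1r. Qed.

Lemma commNr x y : comm x (- y) = - comm x y.
Proof. by rewrite -scaleN1r commZr scaleN1r. Qed.

(** The Jacobi identity, in the form that makes [comm ^~ z] a derivation of
    the bracket. *)
Lemma comm_jacobi x y z :
  comm (comm x z) y + comm x (comm y z) = comm (comm x y) z.
Proof.
have -> : comm (comm x y) z =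
    x * comm y z + comm x z * y - (y * comm x z + comm y z * x).
  by rewrite -!commMl -commNl -commDl.
rewrite [comm (comm x z) y]/comm [comm x (comm y z)]/comm.
by rewrite addrACA opprD; congr (_ + _); rewrite addrC.
Qed.

Fixpoint iter_comm y x j := if j is i.+1 then comm (iter_comm y x i) x else y.

End CommutatorCalculus.

Section Heisenberg.
Context {R : numFieldType} {B : algType R}.
Variables (N : nat) (N_gt0 : (0 < N)%N).
Local Notation n := N.*2.+1.
Variables (F : nat -> B -> Prop) (hF : filtered n F).
Variables (X Y : B) (FX : F 1 X) (FY : F 1 Y).

Local Notation M := (iter_comm Y X).
Local Notation W := (comm (M N.-1) (M N)).
Local Notation exp := (nexp n).

Let n_gt1 : (1 < n)%N. Proof. by lia. Qed.

Lemma fil_comm i j x y : F i x -> F j y -> F (i + j)%N (comm x y).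
Proof.
move=> Fx Fy; apply: (filB hF); first exact: (filM hF).
by rewrite addnC; exact: (filM hF).
Qed.

Lemma fil_iter_comm j : F j.+1 (M j).
Proof.
by elim: j => //= j IH; rewrite -addn1; apply: fil_comm.
Qed.

Lemma iter_comm_big j : (n <= j)%N -> M j = 0.
Proof. by move=> nj; apply: (fil_gt hF _ (fil_iter_comm j)). Qed.

Lemma iter_comm_mulX i : M i * X = X * M i + M i.+1.
Proof. by rewrite /= /comm addrC subrK. Qed.

(** Moving M_i across X creates M_{i+1}; iterating this across X^k/k! gives the
    Leibniz expansion of ad X. *)
Lemma iter_comm_dpow i k :
  M i * dpow k X = \sum_(j < k.+1) dpow (k - j) X * (j`!%:R^-1 *: M (i + j)).
Proof.
elim: k i => [|k IH] i.
  by rewrite big_ord1 dpow0 invr1 scale1r addn0 mulr1 mul1r.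
have k0 := (@factS_neq0 R k).1.
apply: (scalerI k0); rewrite scalerAr -dpowS mulrA iter_comm_mulX mulrDl.
rewrite -mulrA !IH.
have -> : X * \sum_(j < k.+1) dpow (k - j) X * (j`!%:R^-1 *: M (i + j)) =
  \sum_(j < k.+2) (k.+1 - j)%:R *: (dpow (k.+1 - j) X * (j`!%:R^-1 *: M (i + j))).
  rewrite [RHS]big_ord_recr /= subnn scale0r addr0 mulr_sumr.
  by apply: eq_bigr => j _; rewrite mulrA dpowS scalerAl -subSn // -ltnS.
have -> : \sum_(j < k.+1) dpow (k - j) X * (j`!%:R^-1 *: M (i.+1 + j)) =
  \sum_(j < k.+2) j%:R *: (dpow (k.+1 - j) X * (j`!%:R^-1 *: M (i + j))).
  rewrite [RHS]big_ord_recl scale0r add0r.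
  apply: eq_bigr => j _; rewrite lift0 subSS addSnnS.
  by rewrite -!scalerAr scalerA factSV mulrA divff ?mul1r //;
    case: (@factS_neq0 R j).
rewrite -big_split scaler_sumr; apply: eq_bigr => j _ /=.
by rewrite -scalerDl -natrD subnK // -ltnS.
Qed.

(** The divided power t^j/j!, coefficient of M_j in e^{-tX} Y e^{tX}. *)
Definition tpow (t : R) j : R := t ^+ j / j`!%:R.

Definition lincomb (m : nat -> R) : B := \sum_(j < n) m j *: M j.

Lemma fil_lincomb m : F 1 (lincomb m).
Proof.
apply: (fil_sum hF) => j _; apply: (filZ hF).
by apply: (fil_le hF _ (fil_iter_comm j)).
Qed.

Lemma lincombD m m' : lincomb (fun j => m j + m' j) = lincomb m + lincomb m'.
Proof. by rewrite -big_split; apply: eq_bigr => j _; rewrite scalerDl. Qed.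

Lemma lincombZ a m : lincomb (fun j => a * m j) = a *: lincomb m.
Proof. by rewrite scaler_sumr; apply: eq_bigr => j _; rewrite scalerA. Qed.

Lemma eq_lincomb m m' : (forall j, (j < n)%N -> m j = m' j) -> lincomb m = lincomb m'.
Proof. by move=> mm; apply: eq_bigr => j _; rewrite mm. Qed.

(** The identity e^{-tX} Y e^{tX} = sum_j t^j/j! M_j, written without
    inverses. *)
Lemma conj_exp t : Y * exp (t *: X) = exp (t *: X) * lincomb (tpow t).
Proof.
have -> : lincomb (tpow t) = \sum_(j < n.+1) tpow t j *: M j.
  rewrite [RHS]big_ord_recr (_ : M (@ord_max n) = 0); last exact: iter_comm_big.
  by rewrite scaler0 /= addr0.
rewrite /nexp mulr_sumr.
pose f j i := (t ^+ i *: dpow i X) * (tpow t j *: M j).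
have -> : \sum_(k < n.+1) Y * dpow k (t *: X) =
          \sum_(k < n.+1) \sum_(j < k.+1) f j (k - j)%N.
  apply: eq_bigr => k _; rewrite dpowZ -scalerAr (iter_comm_dpow 0) scaler_sumr.
  apply: eq_bigr => j _; rewrite /f /tpow -!scalerAl -!scalerAr !scalerA add0n.
  congr (_ *: _); rewrite -{1}(@subnK j k); last by rewrite -ltnS.
  by rewrite exprD; ring.
rewrite (@sum_triangle _ n f); last first.
  move=> i j nij; rewrite /f; apply: (fil_gt hF nij); rewrite addnC.
  apply: (filM hF); first by apply: (filZ hF); exact: (fil_dpow hF).
  by apply: (filZ hF); apply: (fil_le hF _ (fil_iter_comm i)).
rewrite exchange_big /= /nexp mulr_suml; apply: eq_bigr => i _.
by rewrite dpowZ mulr_sumr.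
Qed.

Lemma exp_tXD s t : exp ((s + t) *: X) = exp (s *: X) * exp (t *: X).
Proof.
rewrite scalerDl (nexpD hF) //; try exact: (filZ hF).
by rewrite -!scalerAl -!scalerAr !scalerA mulrC.
Qed.

Lemma exp_tXN t : exp (- t *: X) * exp (t *: X) = 1.
Proof. by rewrite -exp_tXD addNr scale0r nexp0. Qed.

Lemma exp_kick_flow b t :
  exp (b *: Y) * exp (t *: X) = exp (t *: X) * exp (b *: lincomb (tpow t)).
Proof.
have tN : exp (t *: X) * exp (- t *: X) = 1.
  by rewrite -exp_tXD subrr scale0r nexp0.
have -> : b *: lincomb (tpow t) = exp (- t *: X) * (b *: Y) * exp (t *: X).
  by rewrite -mulrA -scalerAl conj_exp -scalerAr mulrA exp_tXN mul1r.
by rewrite -(nexp_conj _ _ (exp_tXN t) tN) !mulrA tN mul1r.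
Qed.

(** The pullback by a composition of flows is the product of the exponentials
    in the reverse order: the leftmost flow gives the rightmost factor. *)
Fixpoint split_op (ab : seq (R * R)) : B :=
  if ab is (a, b) :: ab' then split_op ab' * exp (b *: Y) * exp (a *: X) else 1.

(** The kicks (t_i, beta_i), where t_i = t + alpha_1 + ... + alpha_i is the
    total drift standing to the right of kick i in the product. *)
Fixpoint nodes (t : R) (ab : seq (R * R)) : seq (R * R) :=
  if ab is (a, b) :: ab' then (t + a, b) :: nodes (t + a) ab' else [::].

Fixpoint kick_prod (pts : seq (R * R)) : B :=
  if pts is p :: l then kick_prod l * exp (p.2 *: lincomb (tpow p.1)) else 1.

(** The factor e^{tX} on the right accumulates the drifts as they are moved
    to the left through the kicks, by induction from the right end. *)
Lemma split_op_kicks t ab :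
  split_op ab * exp (t *: X) =
  exp ((t + \sum_(p <- ab) p.1) *: X) * kick_prod (nodes t ab).
Proof.
elim: ab t => [|[a b] ab IH] t /=; first by rewrite big_nil addr0 mul1r mulr1.
rewrite big_cons /= -!mulrA -exp_tXD [a + t]addrC exp_kick_flow !mulrA IH.
by rewrite -!mulrA addrA.
Qed.

Hypothesis W0 : forall j, (1 <= j <= N - 1)%N -> comm (M j.-1) (M j) = 0.

(** Bracketing [M_i, M_j] = 0 with X gives
    [M_{i+1}, M_j] + [M_i, M_{j+1}] = 0, so on the next antidiagonal the
    brackets are equal up to alternating signs. *)
Lemma iter_comm_antidiag s : (forall i j, (i + j)%N = s -> comm (M i) (M j) = 0) ->
  forall i j, (i + j)%N = s.+1 -> comm (M i) (M j) = (-1) ^+ i *: comm (M 0) (M s.+1).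
Proof.
move=> s0; elim=> [|i IH] j ij; first by rewrite -ij add0n expr0 scale1r.
have /eqP := comm_jacobi (M i) (M j) X.
rewrite (s0 i j) ?[comm 0 X]/comm ?mul0r ?mulr0 ?subr0; last by lia.
rewrite addr_eq0 -/(M i.+1) => /eqP ->; rewrite -/(M j.+1) IH; last by lia.
by rewrite exprS mulN1r scaleNr.
Qed.

(** It suffices to know one zero bracket on each antidiagonal: [M_k, M_k]
    when i + j = 2k, and W_k when i + j = 2k - 1. *)
Lemma iter_comm_low i j : (i + j < N.*2.-1)%N -> comm (M i) (M j) = 0.
Proof.
move sE : (i + j)%N => s; elim: s i j sE => [|s IH] i j ij sN.
  have [-> ->] : i = 0%N /\ j = 0%N by lia.
  exact: commxx.
have {}IH i' j' : (i' + j')%N = s -> comm (M i') (M j') = 0 by move/IH; apply; lia.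
have AD := iter_comm_antidiag IH.
have [k [l [kl lk]]] : exists k l, (k + l)%N = s.+1 /\ comm (M k) (M l) = 0.
  case: (boolP (odd s)) => os.
    by exists s.+1./2, s.+1./2; split; [lia | exact: commxx].
  exists s./2, s./2.+1; split; first by lia.
  by apply: (W0 (j := s./2.+1)); lia.
rewrite (AD _ _ ij).
have := AD _ _ kl; rewrite lk => /(congr1 ( *:%R ((-1) ^+ k))).
by rewrite scaler0 scalerA -exprMn mulrNN mulr1 expr1n scale1r => <-; rewrite scaler0.
Qed.

(** Antidiagonal 2N-1 is the first one where the brackets may be nonzero, and
    it carries order 2N+1; the next ones are beyond the top order. *)
Lemma iter_commE i j : comm (M i) (M j) =
  if (i + j == N.*2.-1)%N then ((-1) ^+ N.-1 * (-1) ^+ i) *: W else 0.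
Proof.
case: eqP => [ij|/eqP]; last first.
  rewrite neq_ltn => /orP[|ij]; first exact: iter_comm_low.
  apply: (fil_gt hF _ (fil_comm (fil_iter_comm i) (fil_iter_comm j))); lia.
have lo i' j' : (i' + j')%N = N.*2.-2 -> comm (M i') (M j') = 0.
  by move=> e; apply: iter_comm_low; lia.
have AD := iter_comm_antidiag lo.
rewrite (AD i j) ?(AD N.-1 N); try lia.
by rewrite scalerA; congr (_ *: _); rewrite mulrAC -expr2 sqrr_sign mul1r.
Qed.

(** The symplectic form of the Heisenberg algebra, normalized by
    W = [M_{N-1}, M_N]. *)
Definition symp (m m' : nat -> R) : R :=
  (-1) ^+ N.-1 * \sum_(i < N.*2) (-1) ^+ i * m i * m' (N.*2.-1 - i)%N.

Lemma comm_lincomb m m' : comm (lincomb m) (lincomb m') = symp m m' *: W.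
Proof.
rewrite comm_suml big_ord_recr /= [X in _ + X]comm_sumr [X in _ + X]big1 ?addr0; last first.
  move=> j _; rewrite commZl commZr iter_commE; case: eqP => [?|_]; first by lia.
  by rewrite !scaler0.
rewrite /symp mulr_sumr scaler_suml; apply: eq_bigr => i _.
rewrite comm_sumr.
have hj : (N.*2.-1 - i < n)%N by lia.
rewrite (bigD1 (Ordinal hj)) //= big1 ?addr0 => [|j].
  rewrite commZl commZr iter_commE subnKC; last by have := ltn_ord i; lia.
  by rewrite eqxx !scalerA; congr (_ *: _); ring.
rewrite -val_eqE /= => ne; rewrite commZl commZr iter_commE; case: eqP => [?|_].
  by case/eqP: ne; lia.
by rewrite !scaler0.
Qed.

Lemma fil_top_comm : F n W.
Proof.
by have -> : n = (N.-1.+1 + N.+1)%N; [lia|apply: fil_comm; exact: fil_iter_comm].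
Qed.

Lemma mul_W x : F 1 x -> x * W = 0 /\ W * x = 0.
Proof.
by move=> Fx; split; apply: (@fil_gt _ _ _ _ hF n.+1) => //;
  [rewrite -add1n | rewrite -addn1]; apply: (filM hF) => //; exact: fil_top_comm.
Qed.

Lemma W_exp x : F 1 x -> W * exp x = W.
Proof.
move=> Fx; have [_ We] := mul_W (fil_nexpB1 hF (j := 0) Fx).
by rewrite -[exp x](subrK 1) mulrDr We add0r mulr1.
Qed.

(** The Heisenberg relation e^z e^z' = e^{z+z'} + [z, z']/2. *)
Lemma exp_lincombD m m' : exp (lincomb m) * exp (lincomb m') =
  exp (lincomb (fun j => m j + m' j)) + (2^-1 * symp m m') *: W.
Proof.
rewrite (nexpD_quasi hF) ?lincombD ?comm_lincomb ?scalerA //; try exact: fil_lincomb.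
by apply: (filZ hF); exact: fil_top_comm.
Qed.

Definition moment (pts : seq (R * R)) j : R := \sum_(p <- pts) p.2 * tpow p.1 j.

(** Half the sum of the symplectic products over pairs of kicks: what the
    Heisenberg relation leaves on W when the exponentials of the kicks are
    merged into one. *)
Fixpoint area (pts : seq (R * R)) : R :=
  if pts is p :: l then
    area l + 2^-1 * symp (moment l) (fun j => p.2 * tpow p.1 j) else 0.

Lemma kick_prodE pts :
  kick_prod pts = exp (lincomb (moment pts)) + area pts *: W.
Proof.
elim: pts => [|[s w] l IH] /=.
  rewrite scale0r addr0 (_ : lincomb _ = 0) ?nexp0 //.
  by rewrite /lincomb big1 // => j _; rewrite /moment big_nil scale0r.
rewrite IH mulrDl -lincombZ exp_lincombD -[_ *: W * _]scalerAl.
rewrite (W_exp (fil_lincomb _)) -addrA -scalerDl; congr (exp _ + _ *: _).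
  by apply: eq_lincomb => j _; rewrite /moment big_cons addrC.
exact: addrC.
Qed.

(** The flow of X + Y is handled with the Euler operator D, whose commutator
    multiplies an operator of degree k in T by k: it replaces T d/dT, and
    [D_inj] is the uniqueness theorem for the corresponding differential
    equations. *)
Section Euler.
Variable (D : B) (DX : comm D X = X) (DY : comm D Y = Y).
Hypothesis D_inj : forall x, F 1 x -> comm D x = 0 -> x = 0.

Lemma comm_der x y : comm D (comm x y) = comm (comm D x) y + comm x (comm D y).
Proof.
have := comm_jacobi x y D; rewrite (comm_anti x D) (comm_anti y D).
by rewrite (comm_anti _ D) commNl commNr -opprD => /oppr_inj ->.
Qed.

Lemma comm_iter j : comm D (M j) = j.+1%:R *: M j.
Proof.
elim: j => [|j IH]; first by rewrite DY scale1r.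
by rewrite [M j.+1]/= comm_der IH DX commZl -[X in _ + X]scale1r -scalerDl natr1.
Qed.

Lemma comm_W : comm D W = n%:R *: W.
Proof.
rewrite comm_der !comm_iter commZl commZr -scalerDl -natrD.
by congr (_%:R *: _); lia.
Qed.

(** The derivative of z^k/k! is z' z^{k-1}/(k-1)! as soon as z commutes with
    z' in words of length at least 3; only k = 2 has a correction. *)
Lemma comm_dpow_der z k : F 1 z -> F 1 (comm D z) -> F n (comm z (comm D z)) ->
  comm D (dpow k.+1 z) =
  comm D z * dpow k z + (if k == 1%N then 2^-1 *: comm z (comm D z) else 0).
Proof.
move=> Fz Fg Fc.
have : z * comm z (comm D z) = 0.
  by apply: (@fil_gt _ _ _ _ hF n.+1) => //; rewrite -add1n; apply: (filM hF).
have : comm z (comm D z) * z = 0.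
  by apply: (@fil_gt _ _ _ _ hF n.+1) => //; rewrite -addn1; apply: (filM hF).
have : z * comm D z = comm D z * z + comm z (comm D z).
  by rewrite [comm z _]/comm addrC subrK.
have : forall x, comm D (z * x) = comm D z * x + z * comm D x by move=> x; rewrite commMr.
have : comm D (dpow 1 z) = comm D z by rewrite dpow1.
move: (comm D z) => g; move: (comm z g) => c D1 DM zg cz zc.
elim: k => [|k IH]; first by rewrite D1 dpow0 mulr1 addr0.
have k0 := (@factS_neq0 R k.+1).1.
apply: (scalerI k0); rewrite -commZr -dpowS DM IH mulrDr.
have -> : z * (if k == 1%N then 2^-1 *: c else 0) = 0.
  by case: ifP; rewrite ?mulr0 // -scalerAr zc scaler0.
rewrite addr0 mulrA zg mulrDl -mulrA dpowS -[g * (_ *: _)]scalerAr addrA.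
rewrite -[X in X + _ + _]scale1r -scalerDl nat1r scalerDr; congr (_ + _).
case: k {IH} k0 => [|k] _ /=.
  by rewrite dpow0 mulr1 scalerA divff ?scale1r // pnatr_eq0.
by rewrite scaler0 /dpow exprS -scalerAr mulrA cz mul0r scaler0.
Qed.

Lemma comm_exp_der z : F 1 z -> F 1 (comm D z) -> F n (comm z (comm D z)) ->
  comm D (exp z) = comm D z * exp z + 2^-1 *: comm z (comm D z).
Proof.
move=> Fz Fg Fc; rewrite {1}/nexp comm_sumr big_ord_recl dpow0.
rewrite {1}/comm mulr1 mul1r subrr add0r.
rewrite (eq_bigr _ (fun (k : 'I_n) _ => comm_dpow_der k Fz Fg Fc)) big_split /=.
congr (_ + _).
  rewrite /nexp [in RHS]big_ord_recr /= mulrDr mulr_sumr [X in _ = _ + X](_ : _ = 0) ?addr0 //.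
  apply: (@fil_gt _ _ _ _ hF n.+1) => //; rewrite -add1n; apply: (filM hF) => //.
  exact: (fil_dpow hF).
rewrite -big_mkcond (big_pred1 (inord 1)) // => i /=.
by rewrite -val_eqE /= inordK // ltnW.
Qed.

Lemma mul_exp_comm (x y : B) : x * y = y * x -> x * exp y = exp y * x.
Proof.
move=> xy; rewrite /nexp mulr_sumr mulr_suml; apply: eq_bigr => k _.
rewrite /dpow -scalerAr -scalerAl; congr (_ *: _).
exact: (@commrX _ x y k xy).
Qed.

(** The moments and the area of the continuous kick dt on [0, 1]: moment1 j
    is the integral of t^j/j!. *)
Definition moment1 j : R := (j.+1`!%:R)^-1.
Definition area1 : R := - (2^-1 * symp moment1 (tpow 1) / n%:R).

(** Both sides solve [D, Z] = (X + Y) Z with constant term 1.  On the right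
    this uses e^X (sum_j M_j/j!) = Y e^X, and [area1] is chosen to cancel the
    symplectic term in the derivative of the second factor. *)
Lemma exp_sum : exp (X + Y) = exp X * (exp (lincomb moment1) + area1 *: W).
Proof.
set S := X + Y; set z := lincomb moment1.
have FS : F 1 S by apply: (filD hF).
have DS : comm D S = S by rewrite commDr DX DY.
have Dz : comm D z = lincomb (tpow 1).
  rewrite comm_sumr; apply: eq_bigr => j _; rewrite commZr comm_iter scalerA.
  by rewrite /moment1 /tpow factSV mulrC mulrA divff ?expr1n //;
    case: (@factS_neq0 R j).
have Fz : F 1 z by exact: fil_lincomb.
set C := exp X * _.
have DexpX : comm D (exp X) = X * exp X.
  by rewrite comm_exp_der ?DX ?commxx ?scaler0 ?addr0 //; exact: (fil0 hF).
have DC : comm D C = S * C.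
  rewrite commMr DexpX commDr commZr comm_W comm_exp_der ?Dz ?comm_lincomb //;
    try exact: fil_lincomb; last by apply: (filZ hF); exact: fil_top_comm.
  rewrite -addrA !scalerA -scalerDl.
  have -> : 2^-1 * symp moment1 (tpow 1) + area1 * n%:R = 0.
    by rewrite /area1 mulNr divfK ?subrr // pnatr_eq0.
  rewrite scale0r addr0 /S mulrDl -mulrA; congr (_ + _).
  rewrite /C [RHS]mulrA -[X in _ = Y * exp X * _]scale1r conj_exp scale1r -mulrA.
  by rewrite mulrDr -[lincomb (tpow 1) * (_ *: W)]scalerAr (mul_W (fil_lincomb _)).1
     scaler0 addr0.
have FNS : F 1 (- S) by exact: (filN hF).
have DNS : comm D (exp (- S)) = - (S * exp (- S)).
  have DmS : comm D (- S) = - S by rewrite commNr DS.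
  rewrite comm_exp_der ?DmS ?commxx ?scaler0 ?addr0 ?mulNr //; last exact: (fil0 hF).
(* The quotient of the two solutions commutes with D, hence it is constant. *)
suff K1 : exp (- S) * C = 1.
  by rewrite -[LHS]mulr1 -K1 mulrA (nexpNr hF) ?mul1r.
apply/eqP; rewrite -subr_eq0; apply/eqP; apply: D_inj.
  have FC : F 1 (C - 1).
    have -> : C - 1 = (exp X - 1) * (exp z + area1 *: W) + (exp z - 1) + area1 *: W.
      by rewrite mulrBl mul1r -addrA [exp z - 1 + _]addrAC addrA subrK.
    apply: (filD hF); last by apply: (filZ hF); apply: (fil_le hF _ fil_top_comm).
    apply: (filD hF); last exact: (fil_nexpB1 hF).
    rewrite -[1%N]addn0; apply: (filM hF); first exact: (fil_nexpB1 hF).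
    apply: (filD hF); first exact: (fil_nexp hF).
    by apply: (filZ hF); apply: (fil_le hF _ fil_top_comm).
  have -> : exp (- S) * C - 1 = exp (- S) * (C - 1) + (exp (- S) - 1).
    by rewrite mulrBr mulr1 addrA subrK.
  apply: (filD hF); last exact: (fil_nexpB1 hF).
  by rewrite -[1%N]add0n; apply: (filM hF) => //; exact: (fil_nexp hF).
rewrite commDr commNr commMr DNS DC.
rewrite {1}/comm mulr1 mul1r subrr oppr0 addr0 mulNr mulrA mul_exp_comm.
  by rewrite addNr.
by rewrite mulNr mulrN.
Qed.

Variable ab : seq (R * R).
Local Notation sigma := (\sum_(p <- ab) p.1).
Local Notation pts := (nodes 0 ab).
Local Notation err := (split_op ab - exp (X + Y)).

Lemma split_opE : split_op ab =
  exp (sigma *: X) * (exp (lincomb (moment pts)) + area pts *: W).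
Proof.
have := split_op_kicks 0 ab.
by rewrite scale0r nexp0 mulr1 add0r kick_prodE.
Qed.

(** At order one only the linear terms of the exponentials count. *)
Lemma err_linear :
  F 2 (err - ((sigma - 1) *: X + (moment pts 0 - 1) *: Y)).
Proof.
have comb1 m : F 2 (lincomb m - m 0%N *: Y).
  rewrite /lincomb big_ord_recl addrAC subrr add0r; apply: (fil_sum hF) => i _.
  apply: (filZ hF); exact: (fil_le hF _ (fil_iter_comm _)).
have exp1 x : F 1 x -> F 2 (exp x - 1 - x) by move=> Fx; apply: (nexp_remainder hF (j:=0)).
have key a m k : F 2 (exp (a *: X) * (exp (lincomb m) + k *: W) - 1 - (a *: X + m 0%N *: Y)).
  set x := a *: X; set z := lincomb m.
  have Fx : F 1 x by apply: (filZ hF).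
  have Fz : F 1 z by exact: fil_lincomb.
  have FW : F 2 (k *: W) by apply: (filZ hF); apply: (fil_le hF _ fil_top_comm); lia.
  have split_err (u v w x' y' z' : B) : (u + 1) * ((v + 1) + w) - 1 - (x' + y') =
      u * v + (u - x') + (v - z') + (z' - y') + (u + 1) * w.
    rewrite mulrDr [in LHS]mulrDl [in LHS]mulrDr mulr1 mul1r.
    rewrite -[in RHS](addrA _ (v - z')) (addrA (v - z')) subrK opprD.
    move: (u * v) ((u + 1) * w) => p q.
    rewrite !addrA.
    have -> : p + u + v + 1 + q - 1 - x' - y' = p + u + v + 1 - 1 + q - x' - y'.
      by rewrite -(addrA _ q) (addrC q) addrA.
    rewrite addrK.
    by rewrite [LHS](ACl (1*2*5*3*6*4))%AC.
  have eE := split_err (exp x - 1) (exp z - 1) (k *: W) x (m 0%N *: Y) z.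
  rewrite !subrK in eE; rewrite eE.
  apply: (filD hF); last first.
    by rewrite -[2%N]add0n; apply: (filM hF) => //; exact: (fil_nexp hF).
  apply: (filD hF); last exact: comb1.
  apply: (filD hF); last exact: (exp1 _ Fz).
  apply: (filD hF); last exact: (exp1 _ Fx).
  by rewrite -[2%N]/(1 + 1)%N; apply: (filM hF); exact: (fil_nexpB1 hF).
have := filB hF (key sigma (moment pts) (area pts)) (key 1 moment1 area1).
rewrite -split_opE !scale1r -exp_sum; congr (F _ _).
rewrite (_ : moment1 0 = 1) ?scale1r; last by rewrite /moment1 invr1.
rewrite !scalerBl !scale1r !opprD !opprK !addrA.
by rewrite [LHS](ACl (1*5*3*7*4*8*(2*6)))%AC /= addNr addr0.
Qed.

Let delta j := moment pts j - moment1 j.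

Lemma fil_lincomb_from k m : (forall i, (i < k)%N -> m i = 0) ->
  F k.+1 (lincomb m) /\ F k.+2 (lincomb m - m k *: M k).
Proof.
move=> m0; have : F k.+2 (lincomb m - m k *: M k).
  have [kn|nk] := ltnP k n; last first.
    rewrite (@iter_comm_big k) // scaler0 subr0 /lincomb big1; first exact: (fil0 hF).
    by move=> j _; rewrite m0 ?scale0r //; apply: leq_trans nk.
  rewrite /lincomb (bigD1 (Ordinal kn)) //= addrAC subrr add0r.
  apply: (fil_sum hF) => i; rewrite -val_eqE /= => ik.
  case: (ltngtP i k) ik => // [ik|ki] _; first by rewrite m0 // scale0r; exact: (fil0 hF).
  by apply: (filZ hF); apply: (fil_le hF _ (fil_iter_comm i)).
move=> h; split => //; rewrite -[lincomb m](subrK (m k *: M k)).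
apply: (filD hF); first by apply: (fil_le hF _ h).
by apply: (filZ hF); exact: fil_iter_comm.
Qed.

(** When sigma = 1 the factor e^X is common to both sides.  If the moments
    agree below order j, the quotient of the two remaining exponentials is the
    exponential of an element starting with delta_j M_j, which is then the
    leading term of the error; W has the same order as M_{2N}, hence shows up
    at j = 2N only. *)
Lemma err_step j : (j <= N.*2)%N -> sigma = 1 -> (forall i, (i < j)%N -> delta i = 0) ->
  F j.+2 (err - (delta j *: M j +
     (if j == N.*2 then (area pts - area1) *: W else 0))).
Proof.
move=> jN s1 d0.
rewrite split_opE s1 scale1r exp_sum -mulrBr.
set z0 := lincomb moment1; set q := area pts - area1 - 2^-1 * symp moment1 delta.
have Fz0 : F 1 z0 by exact: fil_lincomb.
have [Fd Fd'] := fil_lincomb_from d0.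
have -> : exp (lincomb (moment pts)) + area pts *: W - (exp z0 + area1 *: W) =
    exp z0 * (exp (lincomb delta) - 1) + q *: W.
  rewrite mulrBr mulr1 exp_lincombD.
  rewrite (_ : lincomb (fun j => _ + _) = lincomb (moment pts)); last first.
    by apply: eq_lincomb => i _; rewrite /delta addrC subrK.
  rewrite /q !scalerBl opprD !addrA.
  by rewrite [RHS](ACl (1*4*3*5*(2*6)))%AC /= subrr addr0.
have qE : F j.+2 (q *: W - (if j == N.*2 then (area pts - area1) *: W else 0)).
  case: eqP => [jE|/eqP jE]; last first.
    rewrite subr0; apply: (filZ hF); apply: (fil_le hF _ fil_top_comm); lia.
  rewrite /q (_ : symp _ _ = 0) ?mulr0 ?subr0 ?subrr; first exact: (fil0 hF).
  rewrite /symp big1 ?mulr0 // => i _; rewrite d0 ?mulr0 //; lia.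
set e := exp (lincomb delta) - 1.
have Fe : F j.+1 e by exact: (fil_nexpB1 hF).
have Fe' : F j.+2 (e - lincomb delta).
  by apply: (fil_le hF _ (nexp_remainder hF Fd)); lia.
have FqW : F j.+1 (q *: W) by apply: (filZ hF); apply: (fil_le hF _ fil_top_comm).
have split_err (a b w r s t : B) : a * (b * r + w) - (s + t) =
   (a - 1) * (b * r + w) + (b - 1) * r + (r - lincomb delta) + (lincomb delta - s) + (w - t).
  rewrite !mulrBl !mul1r; move: (a * (b * r + w)) => p; move: (b * r) => p'.
  rewrite !opprD !addrA subrK.
  by rewrite [RHS](ACl (1*7*9*(2*4)*(3*8)*(5*6)))%AC /= !addNr !addr0.
rewrite (split_err _ _ _ _ (delta j *: M j)).
have FP : F 0 (exp z0) by exact: (fil_nexp hF).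
apply: (filD hF) => //; apply: (filD hF) => //; apply: (filD hF) => //.
apply: (filD hF).
  rewrite -[j.+2]add1n; apply: (filM hF); first exact: (fil_nexpB1 hF).
  by apply: (filD hF) => //; rewrite -[j.+1]add0n; apply: (filM hF).
by rewrite -[j.+2]add1n; apply: (filM hF) => //; exact: (fil_nexpB1 hF).
Qed.
End Euler.
End Heisenberg.

(** * Moments and area as polynomial quadratures *)

Section TaylorPowers.
Context {R : numFieldType}.

Lemma tpow_add (s t : R) m :
  tpow (s + t) m = \sum_(j < m.+1) tpow s j * tpow t (m - j).
Proof.
rewrite /tpow addrC exprDn mulr_suml; apply: eq_bigr => j _.
have jm : (j <= m)%N by rewrite -ltnS.
have := bin_fact jm => /(congr1 (fun k => k%:R : R)); rewrite !natrM => <-.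
rewrite -mulr_natr.
have f0 k : (k`!%:R : R) != 0 by rewrite pnatr_eq0 -lt0n fact_gt0.
have b0 : ('C(m, j)%:R : R) != 0 by rewrite pnatr_eq0 -lt0n bin_gt0.
by field; rewrite !f0 b0.
Qed.

Lemma tpow0r (t : R) : tpow t 0 = 1.
Proof. by rewrite /tpow expr0 divr1. Qed.

Lemma tpow0S m : tpow (0 : R) m.+1 = 0.
Proof. by rewrite /tpow expr0n mul0r. Qed.

Lemma tpowN (t : R) j : tpow (- t) j = (-1) ^+ j * tpow t j.
Proof. by rewrite /tpow (exprNn t) mulrA. Qed.

(** Both sides are the integral of (1 - t)^m/m! over [0, 1]; the identity
    expands (1 - 1)^{m+1} = 0. *)
Lemma sum_moment1 m :
  \sum_(j < m.+1) (-1) ^+ j * moment1 j * tpow 1 (m - j) = moment1 m :> R.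
Proof.
have := tpow_add (-1) 1 m.+1; rewrite addNr tpow0S big_ord_recl tpow0r mul1r subn0.
move/esym/eqP; rewrite addr_eq0 => /eqP; rewrite {1}/tpow expr1n mul1r => e.
rewrite [RHS]e -sumrN; apply: eq_bigr => j _; rewrite lift0 subSS.
by rewrite tpowN /moment1 [tpow 1 _.+1]/tpow expr1n mul1r exprS !mulN1r !mulNr opprK.
Qed.

Lemma symp_tpow N (s t : R) : (0 < N)%N ->
  symp N (tpow s) (tpow t) = (-1) ^+ N.-1 * tpow (t - s) N.*2.-1.
Proof.
move=> N0; rewrite /symp; congr (_ * _).
rewrite addrC tpow_add; have -> : N.*2 = N.*2.-1.+1 by lia.
by apply: eq_bigr => i _; rewrite tpowN.
Qed.

Lemma symp_moment1 N : (0 < N)%N ->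
  symp N moment1 (tpow 1) = (-1) ^+ N.-1 * moment1 N.*2.-1 :> R.
Proof.
move=> N0; rewrite /symp; congr (_ * _).
by rewrite -sum_moment1; have -> : N.*2 = N.*2.-1.+1 by lia.
Qed.

Lemma area1E N : (0 < N)%N -> area1 N = 2^-1 * (-1) ^+ N * moment1 N.*2 :> R.
Proof.
move=> N0; rewrite /area1 symp_moment1 //.
have -> : (-1) ^+ N = - (-1) ^+ N.-1 :> R by case: (N) N0 => // m _; rewrite exprS mulN1r.
rewrite /moment1 (_ : N.*2.-1.+1 = N.*2); last by lia.
rewrite (factSV N.*2).
by ring.
Qed.

(** On the curve s |-> (s^j/j!)_j the symplectic form is, up to sign, the
    kernel (t - s)^{2N-1}/(2N-1)!. *)
Lemma area_cons N p (l : seq (R * R)) : (0 < N)%N ->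
  area N (p :: l) = area N l +
    2^-1 * (-1) ^+ N * p.2 * \sum_(q <- l) q.2 * tpow (q.1 - p.1) N.*2.-1.
Proof.
move=> N0 /=; congr (_ + _).
have -> : symp N (moment l) (fun j => p.2 * tpow p.1 j) =
          p.2 * \sum_(q <- l) q.2 * symp N (tpow q.1) (tpow p.1).
  rewrite /symp mulr_sumr mulr_sumr.
  under eq_bigr => i _ do rewrite /moment mulr_sumr mulr_suml mulr_sumr.
  rewrite exchange_big /=; apply: eq_bigr => q _.
  by rewrite !mulr_sumr; apply: eq_bigr => i _; ring.
rewrite -!mulrA; congr (_ * _); rewrite [RHS]mulrCA; congr (_ * _).
rewrite mulr_sumr; apply: eq_bigr => q _.
have <- : (-1) ^+ N.-1 * (-1) ^+ N.*2.-1 = (-1) ^+ N :> R.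
  rewrite -exprD -signr_odd -[RHS]signr_odd oddD.
  by case: (N) N0 => // m _ /=; rewrite odd_double; case: (odd m).
by rewrite symp_tpow // -opprB tpowN; ring.
Qed.

End TaylorPowers.

(** * Positivity of the quadratic form *)

Section Spline.
Context {R : realType}.
Variables (N : nat) (N_gt0 : (0 < N)%N).
Implicit Types (Q : {poly R}) (s t w : R).

Definition tpoly m s : {poly R} := (m`!%:R)^-1 *: ('X - s%:P) ^+ m.

Lemma tpoly_eval m s t : (tpoly m s).[t] = tpow (t - s) m.
Proof. by rewrite /tpoly /tpow !hornerE mulrC. Qed.

Lemma deriv_tpoly m s : (tpoly m.+1 s)^`() = tpoly m s.
Proof.
rewrite /tpoly derivZ deriv_exp derivB derivX derivC subr0 mul1r /=.
by rewrite -scalerMnr scalerMnl factSV -mulr_natr mulrAC mulVf ?mul1r //.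
Qed.

Lemma derivn_tpoly m s j : (j <= m)%N -> (tpoly m s)^`(j) = tpoly (m - j) s.
Proof.
elim: j m => [|j IH] m jm; first by rewrite subn0.
by rewrite derivnS IH ?(ltnW jm) // -[(m - j)%N]prednK ?subn_gt0 // deriv_tpoly subnS.
Qed.

(** A polynomial primitive of a nonzero square is nondecreasing, and cannot
    be constant on a nontrivial interval, which would give it infinitely many
    roots. *)
Lemma poly_square_strict (p q : {poly R}) (a b : R) : p^`() = q ^+ 2 -> q != 0 -> a < b ->
  p.[a] < p.[b].
Proof.
move=> pq q0 ab.
have mono x y : x <= y -> p.[x] <= p.[y].
  move=> xy.
  have [c _ e] := @MVT_segment R (horner p) (horner p^`()) x y xy
    (fun z _ => is_derive_poly p z)
    (continuous_subspaceT (@continuous_horner _ p)).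
  by rewrite -subr_ge0 e pq horner_exp mulr_ge0 ?sqr_ge0 ?subr_ge0.
rewrite lt_neqAle mono ?(ltW ab) // andbT; apply/eqP => pab.
have cst x : a <= x -> x <= b -> p.[x] = p.[a].
  by move=> ax xb; apply/eqP; rewrite eq_le (mono _ _ ax) pab (mono _ _ xb).
pose r := p - p.[a]%:P.
have r0 : r = 0.
  apply/eqP; apply: contraT => rn0.
  pose rs := [seq a + (b - a) / i.+1%:R | i <- iota 0 (size r)].
  have := @max_poly_roots _ r rs rn0; rewrite size_map size_iota ltnn => h.
  apply: h.
    apply/allP => x /mapP[i _ ->]; rewrite /root !hornerE cst ?subrr //.
      by rewrite lerDl divr_ge0 // subr_ge0 ltW.
    rewrite -lerBrDl ler_pdivrMr ?ltr0n // ler_peMr ?ler1n // subr_ge0 ltW //.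
  rewrite map_inj_uniq ?iota_uniq // => i j /addrI /mulfI.
  have ba : b - a != 0 by rewrite subr_eq0 gt_eqF.
  by move=> /(_ ba) /invr_inj /eqP; rewrite eqr_nat eqSS => /eqP.
have : p^`() = 0 by rewrite -[p](subrK p.[a]%:P) -/r r0 add0r derivC.
by rewrite pq => /eqP; rewrite sqrf_eq0 (negPf q0).
Qed.

(** The boundary terms of N integrations by parts of the square of Q^(N+1),
    completed by the last integral: altogether a primitive of this square
    when Q^(2N+1) = -1.  Here Q stands for a polynomial piece of the (2N+1)-fold
    primitive of w = sum_i beta_i delta_{t_i} - dt, so that Q^(N+1) is the
    N-fold primitive of w. *)
Definition energy Q : {poly R} :=
  \sum_(k < N) (-1) ^+ k *: (Q^`(N.+1 + k) * Q^`(N - k)) - (-1) ^+ N *: Q.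

Lemma deriv_energy Q : Q^`(N.*2.+1) = (-1)%:P ->
  (energy Q)^`() = Q^`(N.+1) ^+ 2.
Proof.
move=> Qn; pose c k := Q^`(N.+1 + k) * Q^`(N.+1 - k).
rewrite /energy derivB derivZ raddf_sum /=.
have -> : \sum_(k < N) ((-1) ^+ k *: (Q^`(N.+1 + k) * Q^`(N - k)))^`() =
          \sum_(0 <= k < N) ((-1) ^+ k *: c k - (-1) ^+ k.+1 *: c k.+1).
  rewrite big_mkord; apply: eq_bigr => k _.
  rewrite derivZ derivM -!derivnS /c subSS -subSn; last exact: ltnW.
  by rewrite addnS exprS mulN1r scaleNr opprK -scalerDr addrC.
rewrite (@telescope_sumr_eq _ 0 N (fun k => - ((-1) ^+ k *: c k))) //; last first.
  by move=> k _; rewrite opprK addrC.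
rewrite opprK [- _ + _]addrC expr0 scale1r /c addn0 subn0 -expr2.
rewrite subSnn addSn addnn Qn -[Q^`(1)]/(Q^`()) polyCN mulN1r scalerN opprK.
by rewrite addrK.
Qed.

Lemma energyE Q t : (energy Q).[t] =
  \sum_(k < N) (-1) ^+ k * (Q^`(N.+1 + k).[t] * Q^`(N - k).[t]) - (-1) ^+ N * Q.[t].
Proof.
rewrite /energy hornerD hornerN hornerZ horner_sum; congr (_ - _).
by apply: eq_bigr => k _; rewrite hornerZ hornerM.
Qed.

Lemma tpow0E m : tpow (0 : R) m = (m == 0%N)%:R.
Proof. by case: m => [|m]; rewrite ?tpow0r ?tpow0S. Qed.

Lemma derivn_kick Q s w j : (j <= N.*2)%N ->
  (Q + w *: tpoly N.*2 s)^`(j).[s] = Q^`(j).[s] + w * (j == N.*2)%:R.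
Proof.
move=> jN; rewrite derivnD derivnZ derivn_tpoly // hornerD hornerZ tpoly_eval.
by rewrite subrr tpow0E subn_eq0 eqn_leq jN.
Qed.

(** At a kick only the derivative of order 2N of the spline jumps, and it only
    occurs in the last term of the sum, multiplied by Q'. *)
Lemma energy_kick Q s w :
  (energy (Q + w *: tpoly N.*2 s)).[s] =
  (energy Q).[s] + (-1) ^+ N.-1 * (w * Q^`().[s]).
Proof.
have e0 : (Q + w *: tpoly N.*2 s).[s] = Q.[s].
  rewrite hornerD hornerZ tpoly_eval subrr tpow0E (_ : (_ == _) = false) ?mulr0 ?addr0 //.
  by apply/eqP; lia.
have hN : (N.-1 < N)%N by lia.
rewrite !energyE e0 [in RHS]addrAC; congr (_ - _).
rewrite [in LHS](bigD1 (Ordinal hN)) // [in RHS](bigD1 (Ordinal hN)) // addrAC.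
congr (_ + _).
  rewrite -[nat_of_ord (Ordinal hN)]/(N.-1).
  rewrite (_ : N.+1 + N.-1 = N.*2)%N; last by lia.
  rewrite (_ : N - N.-1 = 1)%N; last by lia.
  rewrite !derivn_kick ?(ltnW (_ : 1 < N.*2)%N) ?eqxx //; try lia.
  rewrite (_ : (1 == N.*2)%N = false); last by apply/eqP; lia.
  by rewrite mulr1n mulr0n -[Q^`(1)]/(Q^`()); ring.
apply: eq_bigr => k kN'; have {kN'} kN : nat_of_ord k != N.-1 := kN'; have := ltn_ord k => kN'.
rewrite !derivn_kick; try lia.
rewrite (_ : ((N.+1 + k)%N == N.*2)%N = false); last by apply/eqP; lia.
rewrite (_ : (N - k == N.*2)%N = false); last by apply/eqP; lia.
by rewrite !mulr0 !addr0.
Qed.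

(** The sum of the jumps of the energy along a sequence of kicks, up to the
    sign (-1)^(N-1). *)
Fixpoint work Q (pts : seq (R * R)) : R :=
  if pts is p :: l then p.2 * Q^`().[p.1] + work (Q + p.2 *: tpoly N.*2 p.1) l else 0.

(** The interaction between pairs of kicks in [work] is the same double sum as
    in [area]. *)
Lemma workE Q pts : work Q pts =
  \sum_(p <- pts) p.2 * Q^`().[p.1] + 2 * (-1) ^+ N * area N pts.
Proof.
elim: pts Q => [|[s w] l IH] Q; first by rewrite big_nil /= mulr0 addr0.
rewrite [LHS]/= IH big_cons area_cons //= -addrA; congr (_ + _).
rewrite mulrDr addrA [in RHS]addrAC; congr (_ + _).
have -> : 2 * (-1) ^+ N * (2^-1 * (-1) ^+ N * w * \sum_(q <- l) q.2 * tpow (q.1 - s) N.*2.-1)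
     = \sum_(q <- l) q.2 * (w * tpow (q.1 - s) N.*2.-1).
  transitivity (2 * 2^-1 * ((-1) ^+ N * (-1) ^+ N) * w *
    \sum_(q <- l) q.2 * tpow (q.1 - s) N.*2.-1); first by ring.
  rewrite divff ?pnatr_eq0 // mul1r -expr2 sqrr_sign mul1r mulr_sumr.
  by apply: eq_bigr => q _; ring.
rewrite -big_split; apply: eq_bigr => q _ /=; rewrite -mulrDr; congr (_ * _).
rewrite derivD derivZ; have -> : N.*2 = N.*2.-1.+1 by lia.
by rewrite deriv_tpoly hornerD hornerZ tpoly_eval.
Qed.

(** Between kicks Q^(N+1) has degree exactly N, hence it is not zero and the
    energy increases strictly. *)
Lemma energy_drift Q (a b : R) : Q^`(N.*2.+1) = (-1)%:P -> a <= b ->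
  (energy Q).[a] <= (energy Q).[b] ?= iff (a == b).
Proof.
move=> Qn ab.
have lt : a != b -> (energy Q).[a] < (energy Q).[b].
  move=> ne; apply: (poly_square_strict (deriv_energy Qn)); last by rewrite lt_neqAle ne.
  apply/eqP => Q0; have := Qn.
  have -> : N.*2.+1 = (N + N.+1)%N by lia.
  rewrite /derivn iterD -!/(derivn _ _) Q0 derivn_poly0 ?size_poly0 //.
  by move/(congr1 (fun p => p.[0])) => /eqP; rewrite /= horner0 hornerC eq_sym oppr_eq0 oner_eq0.
split; have [->|ne] := eqVneq a b => //; first exact: ltW (lt ne).
  by rewrite eqxx.
by rewrite lt_eqF ?lt.
Qed.

Definition spline_after Q (pts : seq (R * R)) := Q + \sum_(p <- pts) p.2 *: tpoly N.*2 p.1.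

(** The energy gained along the path is at least the work of the kicks, with
    equality only if no time elapses; the assumption on the drift times is
    used to move forward in time. *)
Lemma energy_path (ab : seq (R * R)) t Q :
  all (fun p => 0 <= p.1) ab -> Q^`(N.*2.+1) = (-1)%:P ->
  let t' := t + \sum_(p <- ab) p.1 in
  t <= t' /\
  (energy Q).[t] + (-1) ^+ N.-1 * work Q (nodes t ab)
    <= (energy (spline_after Q (nodes t ab))).[t'] ?= iff (t == t').
Proof.
elim: ab t Q => [|[a b] ab IH] t Q /=.
  by rewrite big_nil addr0 mulr0 addr0 /spline_after big_nil addr0 eqxx => _ _; split=> //; split; rewrite ?eqxx.
move=> /andP[a0 ab0]; rewrite -derivnS => Qn; rewrite big_cons /= addrA.
have Qn' : (Q + b *: tpoly N.*2 (t + a))^`(N.*2.+1) = (-1)%:P.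
  have k0 : (tpoly N.*2 (t + a))^`(N.*2.+1) = 0.
    by rewrite derivnS derivn_tpoly // subnn /tpoly expr0 -polyC1 derivZ derivC scaler0.
  by rewrite derivnD derivnZ Qn k0 scaler0 addr0.
have [le1 le2] := IH (t + a) _ ab0 Qn'.
have ta : t <= t + a by rewrite lerDl.
split; first exact: le_trans le1.
rewrite /spline_after big_cons /= addrA -/(spline_after _ _).
have := energy_drift Qn ta => dr.
have -> : (energy Q).[t] + (-1) ^+ N.-1 * (b * Q^`().[t + a] +
       work (Q + b *: tpoly N.*2 (t + a)) (nodes (t + a) ab)) =
     (energy Q).[t] - (energy Q).[t + a] + ((energy (Q + b *: tpoly N.*2 (t + a))).[t + a] +
     (-1) ^+ N.-1 * work (Q + b *: tpoly N.*2 (t + a)) (nodes (t + a) ab)).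
  by rewrite energy_kick; ring.
set P := (energy (spline_after _ _)).[_] in le2 *.
rewrite -[P]add0r.
have dr' : (energy Q).[t] - (energy Q).[t + a] <= 0 ?= iff (t == t + a).
  by rewrite leifBLR add0r.
suff -> : (t == t + a + \sum_(p <- ab) p.1) = (t == t + a) && (t + a == t + a + \sum_(p <- ab) p.1).
  exact: leifD.
apply/eqP/andP => [e|[/eqP e1 /eqP e2]]; last by rewrite -e2.
have e1 : t = t + a by apply/eqP; rewrite eq_le ta /= [X in _ <= X]e.
by split; apply/eqP => //; rewrite -e -e1.
Qed.

Lemma derivn_sum (I : Type) (r : seq I) (f : I -> {poly R}) j :
  (\sum_(i <- r) f i)^`(j) = \sum_(i <- r) (f i)^`(j).
Proof.
elim: r => [|i r IH]; first by rewrite !big_nil derivn_poly0 ?size_poly0.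
by rewrite !big_cons derivnD IH.
Qed.

(** The spline before the first kick: the (2N+1)-fold primitive of -dt that
    vanishes at 0 with its derivatives of order at most 2N. *)
Definition spline0 : {poly R} := - tpoly N.*2.+1 0.

(** A quadrature that is exact on the monomials of degree at most m is exact
    on (1 - t)^m/m!. *)
Lemma moment_eval pts m :
  (forall j, (j <= m)%N -> moment pts j = moment1 j) ->
  \sum_(p <- pts) p.2 * tpow (1 - p.1) m = moment1 m :> R.
Proof.
move=> mom; rewrite -sum_moment1.
under eq_bigr => p _ do rewrite addrC tpow_add mulr_sumr.
rewrite exchange_big /=; apply: eq_bigr => j _.
rewrite -mom; last by rewrite -ltnS.
rewrite /moment mulr_sumr mulr_suml; apply: eq_bigr => p _.
by rewrite tpowN; ring.
Qed.

(** The energy vanishes at time 0 by the choice of the initial spline, and at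
    time 1 because the derivatives of the final spline there are moments of
    w.  The equality of the areas says that the work vanishes, whereas the
    energy increases strictly between 0 and 1. *)
Lemma no_positive_quadrature (ab : seq (R * R)) :
  all (fun p => 0 <= p.1) ab -> \sum_(p <- ab) p.1 = 1 ->
  (forall j, (j <= N.*2)%N -> moment (nodes 0 ab) j = moment1 j) ->
  area N (nodes 0 ab) = area1 N -> False.
Proof.
move=> ab0 s1 mom ar.
have Qd j : (j <= N.*2.+1)%N -> spline0^`(j) = - tpoly (N.*2.+1 - j) 0.
  by move=> jN; rewrite derivnN derivn_tpoly.
have Qn : spline0^`(N.*2.+1) = (-1)%:P.
  by rewrite Qd // subnn /tpoly invr1 scale1r expr0 polyCN.
have [_] := energy_path 0 ab0 Qn.
set pts := nodes 0 ab in mom ar *; rewrite s1 add0r.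
have -> : (energy spline0).[0] = 0.
  rewrite energyE big1 => [|k _].
    by rewrite hornerN tpoly_eval subr0 tpow0E oppr0 mulr0 subr0.
  rewrite (Qd (N - k)%N); last by lia.
  rewrite hornerN tpoly_eval subr0 tpow0E (_ : (_ == _) = false) ?oppr0 ?mulr0 //.
  by apply/eqP; lia.
have -> : (energy (spline_after spline0 pts)).[1] = 0.
  have z j : (j <= N.*2)%N -> (spline_after spline0 pts)^`(j).[1] = 0.
    move=> jN; rewrite /spline_after derivnD Qd; last by lia.
    rewrite derivn_sum hornerD hornerN tpoly_eval subr0 horner_sum.
    under eq_bigr => p _ do rewrite derivnZ derivn_tpoly // hornerZ tpoly_eval.
    rewrite moment_eval; last by move=> i ij; apply: mom; lia.
    by rewrite /moment1 /tpow expr1n mul1r -subSn // addNr.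
  rewrite energyE big1 => [|k _].
    by rewrite -[(spline_after _ _).[1]]/((spline_after _ _)^`(0).[1]) z // mulr0 subrr.
  by rewrite (z (N - k)%N) ?mulr0 //; lia.
have -> : work spline0 pts = 0.
  rewrite workE ar area1E //.
  have -> : \sum_(p <- pts) p.2 * spline0^`().[p.1] = - moment1 N.*2.
    rewrite -mom // /moment -sumrN; apply: eq_bigr => p _.
    by rewrite -derivn1 Qd // hornerN tpoly_eval subr0 subSS subn0 mulrN.
  transitivity (moment1 N.*2 * ((2 * 2^-1) * ((-1) ^+ N * (-1) ^+ N) - 1) : R); first by ring.
  by rewrite divff ?pnatr_eq0 // -expr2 sqrr_sign mulr1 subrr mulr0.
by rewrite mulr0 addr0 => -[_]; rewrite eqxx eq_sym oner_eq0.
Qed.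

End Spline.

(** * Smooth functions, Lie derivatives and Lie brackets *)

Section SmoothFunctions.
Context {R : realType} {d : nat}.
Local Notation V := 'rV[R]_d.
Implicit Types (h k : V -> R) (f g : V -> V) (x v : V).

Fixpoint class_Cr (n : nat) h : Prop :=
  match n with
  | 0 => continuous h
  | m.+1 => (forall x, differentiable h x) /\
            (forall v, class_Cr m (fun x => 'd h x v))
  end.

Definition smoothr h : Prop := forall n, class_Cr n h.

Lemma class_Cr_le n h : class_Cr n.+1 h -> class_Cr n h.
Proof.
elim: n h => [|n IH] h [hd hC].
  by move=> x; apply: differentiable_continuous.
by split => // v; apply: IH.
Qed.

Lemma smoothr_diff h x : smoothr h -> differentiable h x.
Proof. by move=> hs; have [] := hs 1%N. Qed.

Lemma smoothr_dir h v : smoothr h -> smoothr (fun x => 'd h x v).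
Proof. by move=> hs n; exact: (hs n.+1).2. Qed.

Lemma smoothr_continuous h : smoothr h -> continuous h.
Proof. by move=> hs; exact: (hs 0%N). Qed.

Lemma smoothrP h : (forall x, differentiable h x) ->
  (forall v, smoothr (fun x => 'd h x v)) -> smoothr h.
Proof.
move=> hd hs [|n]; first by move=> x; apply: differentiable_continuous.
by split => // v; apply: hs.
Qed.

Lemma smoothr_cst (c : R) : smoothr (cst c).
Proof.
move=> n; elim: n c => [|n IH] c /=; first exact: cst_continuous.
split=> [x|v]; first exact: differentiable_cst.
have -> : (fun x => 'd (cst c) x v) = cst 0 by apply/funext => x; rewrite diff_cst.
exact: IH.
Qed.

Lemma smoothrD h k : smoothr h -> smoothr k -> smoothr (h \+ k).
Proof.
move=> hs ks n; elim: n h k hs ks => [|n IH] h k hs ks.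
  by move=> x; apply: continuousD; apply: smoothr_continuous.
split=> [x|v]; first by apply: differentiableD; exact: smoothr_diff.
have -> : (fun x => 'd (h \+ k) x v) = (fun x => 'd h x v) \+ (fun x => 'd k x v).
  apply/funext => x.
  exact: (congr1 (fun F => F v) (diffD (smoothr_diff x hs) (smoothr_diff x ks))).
by apply: IH; exact: smoothr_dir.
Qed.

Lemma smoothrZ (c : R) h : smoothr h -> smoothr (c \*: h).
Proof.
move=> hs n; elim: n h hs => [|n IH] h hs.
  by move=> x; apply: continuousZl_tmp; apply: smoothr_continuous.
split=> [x|v]; first by apply: differentiableZ; exact: smoothr_diff.
have -> : (fun x => 'd (c \*: h) x v) = c \*: (fun x => 'd h x v).
  apply/funext => x.
  exact: (congr1 (fun F => F v) (diffZ c (smoothr_diff x hs))).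
by apply: IH; exact: smoothr_dir.
Qed.

(** The Leibniz rule brings in products of h with derivatives of k, of
    different smoothness, so the induction is on classes C^n. *)
Lemma smoothrM h k : smoothr h -> smoothr k -> smoothr (fun x => h x * k x).
Proof.
suff gen n : forall h k, class_Cr n h -> class_Cr n k -> class_Cr n (fun x => h x * k x).
  by move=> hs ks n; apply: gen.
elim: n => [|n IH] {}h {}k; first by move=> hc kc x; apply: continuousM; [exact: hc|exact: kc].
move=> hC kC; have [hd hd'] := hC; have [kd kd'] := kC; split=> [x|v].
  by apply: differentiableM; [exact: hd|exact: kd].
have -> : (fun x => 'd (fun x => h x * k x) x v) =
    (fun x => h x * 'd k x v) \+ (fun x => k x * 'd h x v).
  by apply/funext => x; exact: (congr1 (fun F => F v) (diffM (hd x) (kd x))).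
have add m h1 h2 : class_Cr m h1 -> class_Cr m h2 -> class_Cr m (h1 \+ h2).
  elim: m h1 h2 => [|m IHm] h1 h2.
    by move=> c1 c2 x; apply: continuousD; [exact: c1|exact: c2].
  move=> [c1 c1'] [c2 c2']; split => [x|u]; first exact: differentiableD.
  have -> : (fun x => 'd (h1 \+ h2) x u) = (fun x => 'd h1 x u) \+ (fun x => 'd h2 x u).
    by apply/funext => x; exact: (congr1 (fun F => F u) (diffD (c1 x) (c2 x))).
  exact: IHm (c1' u) (c2' u).
exact: add (IH _ _ (class_Cr_le hC) (kd' v)) (IH _ _ (class_Cr_le kC) (hd' v)).
Qed.

Lemma smoothr_sum (I : Type) (r : seq I) (P : pred I) (F : I -> V -> R) :
  (forall i, P i -> smoothr (F i)) -> smoothr (fun x => \sum_(i <- r | P i) F i x).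
Proof.
move=> Fs; elim: r => [|i r IH].
  have -> : (fun x => \sum_(i <- [::] | P i) F i x) = cst 0.
    by apply/funext => x; rewrite big_nil.
  exact: smoothr_cst.
have -> : (fun x => \sum_(i <- i :: r | P i) F i x) =
    if P i then F i \+ (fun x => \sum_(i <- r | P i) F i x)
    else (fun x => \sum_(i <- r | P i) F i x).
  by case: ifP => Pi; apply/funext => x; rewrite big_cons Pi.
by case: ifP => // Pi; apply: smoothrD => //; exact: Fs.
Qed.

Definition coordr (i : 'I_d) : V -> R := fun x => x 0 i.

Lemma diff_coordr i x v : 'd (coordr i) x v = v 0 i.
Proof.
have lin : linear (coordr i) by move=> a u w; rewrite /coordr !mxE.
pose f : {linear V -> R} := HB.pack (coordr i) (GRing.isLinear.Build _ _ _ _ _ lin).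
by rewrite -[coordr i]/(f : V -> R) diff_lin //; exact: coord_continuous.
Qed.

Lemma smoothr_coord i : smoothr (coordr i).
Proof.
apply: smoothrP => [x|v]; first exact: differentiable_coord.
have -> : (fun x => 'd (coordr i) x v) = cst (v 0 i).
  by apply/funext => x; rewrite diff_coordr.
exact: smoothr_cst.
Qed.

(** Smoothness of a vector field through its coordinates, which reduces
    everything to scalar functions. *)
Definition vsmooth f := forall i, smoothr (fun x => f x 0 i).

Lemma diff_comp_coord f x i v : differentiable f x ->
  'd (fun y => f y 0 i) x v = ('d f x v) 0 i.
Proof.
move=> fd.
have -> : (fun y => f y 0 i) = coordr i \o f by [].
by rewrite diff_comp //= ?diff_coordr //; exact: differentiable_coord.
Qed.

Lemma smooth_vsmooth f : smooth f -> vsmooth f.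
Proof.
move=> fs i n; have := fs n; elim: n f {fs} => [|n IH] f.
  by move=> fc x; apply: (@continuous_comp _ _ _ f (coordr i)); [exact: fc|exact: coord_continuous].
move=> [fd fd']; split=> [x|v].
  by apply: (@differentiable_comp _ _ _ _ f (coordr i)); [exact: fd|exact: differentiable_coord].
have -> : (fun x => 'd (fun x => f x 0 i) x v) = (fun x => ('d f x v) 0 i).
  by apply/funext => x; rewrite diff_comp_coord.
exact: (IH _ (fd' v)).
Qed.

Lemma vsmooth_diff f x : vsmooth f -> differentiable f x.
Proof.
move=> fs.
have -> : f = \sum_(i < d) (fun y => f y 0 i *: delta_mx 0 i).
  by apply/funext => y; rewrite fct_sumE {1}[f y]row_sum_delta.
apply: differentiable_sum => i; apply: differentiableZl.
exact: smoothr_diff (fs i).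
Qed.

Definition lieD f h : V -> R := fun x => 'd h x (f x).

Lemma diff_coords h x v : 'd h x v = \sum_(i < d) v 0 i * 'd h x (delta_mx 0 i).
Proof.
by rewrite {1}[v]row_sum_delta linear_sum; apply: eq_bigr => i _; rewrite linearZ.
Qed.

Lemma lieDE f h : lieD f h = fun x => \sum_(i < d) f x 0 i * 'd h x (delta_mx 0 i).
Proof. by apply/funext => x; exact: diff_coords. Qed.

Lemma smoothr_lieD f h : vsmooth f -> smoothr h -> smoothr (lieD f h).
Proof.
move=> fs hs; rewrite lieDE; apply: smoothr_sum => i _.
by apply: smoothrM; [exact: fs | exact: smoothr_dir].
Qed.

Lemma lie_bracket_coord f g x i : vsmooth f -> vsmooth g ->
  lie_bracket f g x 0 i = lieD f (fun y => g y 0 i) x - lieD g (fun y => f y 0 i) x.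
Proof.
move=> fs gs; rewrite /lie_bracket /lieD !mxE.
by rewrite !diff_comp_coord //; exact: vsmooth_diff.
Qed.

Lemma vsmooth_lie_bracket f g : vsmooth f -> vsmooth g -> vsmooth (lie_bracket f g).
Proof.
move=> fs gs i.
have -> : (fun x => lie_bracket f g x 0 i) =
   lieD f (fun y => g y 0 i) \+ (-1) \*: lieD g (fun y => f y 0 i).
  by apply/funext => x; rewrite lie_bracket_coord //= scaleN1r.
apply: smoothrD; first by apply: smoothr_lieD.
by apply: smoothrZ; apply: smoothr_lieD.
Qed.

End SmoothFunctions.

Section Brackets.
Context {R : realType} {d : nat}.
Local Notation V := 'rV[R]_d.
Implicit Types (h k : V -> R) (f g : V -> V) (x v : V).

Lemma is_derive_curve h (phi : R -> V) (t : R) (w : V) :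
  differentiable h (phi t) -> is_derive t (1 : R) phi w ->
  is_derive t (1 : R) (h \o phi) ('d h (phi t) w).
Proof.
move=> hd [pd pw].
have pd' : differentiable phi t by apply/derivable1_diffP.
have hpd : differentiable (h \o phi) t by apply: differentiable_comp.
apply: DeriveDef; first by apply/derivable1_diffP.
by rewrite deriveE // diff_comp //= -pw deriveE.
Qed.

Lemma is_derive_line (y u : V) (s : R) : is_derive s (1 : R) (fun s => y + s *: u) u.
Proof.
have D : is_diff s (cst y + ( *:%R^~ u) : R -> V) (0 + *:%R^~ u) by apply: is_diffD.
have dD : differentiable (cst y + ( *:%R^~ u) : R -> V) s by apply: ex_diff.
apply: DeriveDef; first by apply/derivable1_diffP.
by rewrite deriveE // diff_val /= add0r scale1r.
Qed.

Lemma diff_shift h (w y : V) : differentiable h (y + w) ->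
  differentiable (fun z => h (z + w)) y /\
  ('d (fun z => h (z + w)) y : V -> R) = 'd h (y + w).
Proof.
move=> hd.
have D : is_diff y (id + cst w : V -> V) (id + 0) by apply: is_diffD.
have dD : differentiable (id + cst w : V -> V) y by apply: ex_diff.
split; first exact: (differentiable_comp dD hd).
apply/funext => u.
have := congr1 (fun F => F u) (diff_comp dD hd).
by rewrite /= diff_val /= addr0.
Qed.

Lemma MVT_line h (y u : V) (s : R) : 0 < s -> (forall x, differentiable h x) ->
  exists2 c, 0 <= c <= s & h (y + s *: u) - h y = s * 'd h (y + c *: u) u.
Proof.
move=> s0 hd.
have der c : is_derive c (1 : R) (h \o (fun s => y + s *: u)) ('d h (y + c *: u) u).
  exact: (is_derive_curve (hd _) (is_derive_line y u c)).
have cont : {within `[0, s], continuous (h \o (fun s => y + s *: u))}.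
  apply: continuous_subspaceT => c; apply: differentiable_continuous.
  by apply/derivable1_diffP; case: (der c).
have [c cI /= e] := MVT s0 (fun c _ => der c) cont.
exists c; first by move: cI; rewrite in_itv /= => /andP[/ltW -> /ltW ->].
by move: e; rewrite scale0r addr0 subr0 mulrC.
Qed.

(** Two applications of the mean value theorem to a second difference; its
    symmetry in u and v gives the symmetry of second derivatives. *)
Lemma second_difference h x (u v : V) (s : R) : 0 < s -> smoothr h ->
  exists c c', [/\ 0 <= c <= s, 0 <= c' <= s &
    h (x + s *: u + s *: v) - h (x + s *: u) - h (x + s *: v) + h x =
    s ^+ 2 * 'd (fun y => 'd h y u) (x + c *: u + c' *: v) v].
Proof.
move=> s0 hs.
pose w := s *: v.
have hd y : differentiable (fun z => h (z + w)) y.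
  by apply: (diff_shift _).1; exact: smoothr_diff.
have sh y : differentiable (fun z => h (z + w) - h z) y.
  by apply: (@differentiableB _ _ _ _ h) => //; exact: smoothr_diff.
have [c c1 e] := @MVT_line (fun y => h (y + w) - h y) x u s s0 sh.
have dw y : 'd (fun y => h (y + w) - h y) y u = 'd h (y + w) u - 'd h y u.
  have e1 := congr1 (fun F => F u) (diff_shift (smoothr_diff (y + w) hs)).2.
  apply: (etrans (congr1 (fun F => F u) (diffB (hd y) (smoothr_diff y hs)))).
  exact: (congr1 (fun z => z - 'd h y u) e1).
have [c' c2 e'] := @MVT_line (fun y => 'd h y u) (x + c *: u) v s s0
   (fun x => smoothr_diff x (smoothr_dir u hs)).
exists c, c'; split=> //.
by rewrite expr2 -mulrA -e' -[s *: v]/w -dw -e; ring.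
Qed.

Lemma schwarz h x (u v : V) : smoothr h ->
  'd (fun y => 'd h y u) x v = 'd (fun y => 'd h y v) x u.
Proof.
move=> hs.
pose A := 'd (fun y => 'd h y u) x v; pose B := 'd (fun y => 'd h y v) x u.
suff : ~ (A - B != 0) by move=> /negP; rewrite negbK subr_eq0 => /eqP.
move=> ne.
pose e := `|A - B| / 2.
have e0 : 0 < e by rewrite divr_gt0 // normr_gt0.
have cA : {for x, continuous (fun y => 'd (fun y => 'd h y u) y v)}.
  by apply: smoothr_continuous; do 2 apply: smoothr_dir.
have cB : {for x, continuous (fun y => 'd (fun y => 'd h y v) y u)}.
  by apply: smoothr_continuous; do 2 apply: smoothr_dir.
have [r r0 nA] : exists2 r, 0 < r & forall y, `|x - y| < r ->
    `|A - 'd (fun y => 'd h y u) y v| < e /\ `|B - 'd (fun y => 'd h y v) y u| < e.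
  move/cvgrPdist_lt: cA => /(_ e e0) cA; move/cvgrPdist_lt: cB => /(_ e e0) cB.
  have [r /= r0 nr] := (nbhs_normP _ _).1 (filterI cA cB).
  by exists r => // y ry; exact: nr.
pose s := r / (1 + `|u| + `|v|) / 2.
have n0 : 0 < 1 + `|u| + `|v| by rewrite -addrA ltr_pwDl // addr_ge0.
have s0 : 0 < s by rewrite !divr_gt0.
have close c c' (u' v' : V) : 0 <= c <= s -> 0 <= c' <= s -> `|u'| + `|v'| = `|u| + `|v| ->
    `|x - (x + c *: u' + c' *: v')| < r.
  move=> /andP[c0 cs] /andP[c0' cs'] uv.
  rewrite -addrA opprD addrA subrr sub0r normrN.
  apply: le_lt_trans (ler_normD _ _) _; rewrite !normrZ !ger0_norm //.
  apply: (@le_lt_trans _ _ (s * (`|u'| + `|v'|))).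
    by rewrite mulrDr lerD // ler_wpM2r.
  have -> : s * (`|u'| + `|v'|) = r * ((`|u| + `|v|) / ((1 + `|u| + `|v|) * 2)).
    by rewrite uv /s invfM; ring.
  rewrite gtr_pMr // ltr_pdivrMr ?mulr_gt0 // mul1r.
  by have := normr_ge0 u; have := normr_ge0 v; lra.
have [c [c' [c1 c2 E1]]] := second_difference x u v s0 hs.
have [b [b' [b1 b2 E2]]] := second_difference x v u s0 hs.
have EE : 'd (fun y => 'd h y u) (x + c *: u + c' *: v) v =
          'd (fun y => 'd h y v) (x + b *: v + b' *: u) u.
  have s2 : s ^+ 2 != 0 by rewrite expf_eq0 /= gt_eqF.
  apply: (mulfI s2); rewrite -E1 -E2 -[x + s *: v + _]addrA [s *: v + _]addrC addrA.
  by ring.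
have [h1 _] := nA _ (close _ _ u v c1 c2 erefl).
have [_ h2] := nA _ (close _ _ v u b1 b2 (addrC _ _)).
have {}h1 := eq_ind _ (fun z => `|A - z| < e) h1 _ EE.
move: h1 h2; move: ('d _ _ _) => P h1 h2.
have : `|A - B| < e + e.
  apply: le_lt_trans (ltrD h1 h2).
  apply: le_trans (ler_normB _ _).
  by rewrite opprB addrA subrK.
by rewrite -splitr ltxx.
Qed.

Lemma lieDD f h k : smoothr h -> smoothr k -> lieD f (h \+ k) = lieD f h \+ lieD f k.
Proof.
move=> hs ks; apply/funext => x.
exact: (congr1 (fun F => F (f x)) (diffD (smoothr_diff x hs) (smoothr_diff x ks))).
Qed.

Lemma lieDZ f (c : R) h : smoothr h -> lieD f (c \*: h) = c \*: lieD f h.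
Proof.
move=> hs; apply/funext => x.
exact: (congr1 (fun F => F (f x)) (diffZ c (smoothr_diff x hs))).
Qed.

Lemma lieDM f h k : smoothr h -> smoothr k ->
  lieD f (fun x => h x * k x) = fun x => h x * lieD f k x + k x * lieD f h x.
Proof.
move=> hs ks; apply/funext => x.
exact: (congr1 (fun F => F (f x)) (diffM (smoothr_diff x hs) (smoothr_diff x ks))).
Qed.

Lemma lieD0 f : lieD f (cst 0) = cst 0.
Proof. by apply/funext => x; rewrite /lieD diff_cst. Qed.

Lemma lieD_sum f (I : Type) (r : seq I) (F : I -> V -> R) :
  (forall i, smoothr (F i)) ->
  lieD f (fun x => \sum_(i <- r) F i x) = fun x => \sum_(i <- r) lieD f (F i) x.
Proof.
move=> Fs; elim: r => [|i r IH].
  under eq_fun do rewrite big_nil.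
  by under [RHS]eq_fun do rewrite big_nil; exact: lieD0.
under eq_fun do rewrite big_cons.
under [RHS]eq_fun do rewrite big_cons.
have := lieDD f (Fs i) (@smoothr_sum _ _ _ r xpredT F (fun i _ => Fs i)).
by move=> ->; rewrite IH.
Qed.

(** By the symmetry of second derivatives the second order part is symmetric
    in f and g, and disappears from their commutator. *)
Lemma lieD_lieD f g h x : vsmooth f -> vsmooth g -> smoothr h ->
  lieD f (lieD g h) x =
  \sum_(i < d) \sum_(j < d) f x 0 i * g x 0 j *
      'd (fun y => 'd h y (delta_mx 0 j)) x (delta_mx 0 i) +
  \sum_(i < d) 'd h x (delta_mx 0 i) * lieD f (fun y => g y 0 i) x.
Proof.
move=> fs gs hs; rewrite (lieDE g h).
have sm i : smoothr (fun y => g y 0 i * 'd h y (delta_mx 0 i)).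
  by apply: smoothrM => //; exact: smoothr_dir.
rewrite (lieD_sum f _ sm) exchange_big -big_split; apply: eq_bigr => j _ /=.
rewrite lieDM //; last exact: smoothr_dir.
congr (_ + _); rewrite lieDE mulr_sumr; apply: eq_bigr => i _.
by rewrite mulrA [g x 0 j * _]mulrC.
Qed.

Lemma lieD_bracket f g h : vsmooth f -> vsmooth g -> smoothr h ->
  lieD (lie_bracket f g) h = fun x => lieD f (lieD g h) x - lieD g (lieD f h) x.
Proof.
move=> fs gs hs; apply/funext => x.
rewrite !lieD_lieD // [X in _ = _ - (X + _)]exchange_big /=.
have -> : \sum_(j < d) \sum_(i < d) g x 0 i * f x 0 j *
      'd (fun y => 'd h y (delta_mx 0 j)) x (delta_mx 0 i) =
    \sum_(i < d) \sum_(j < d) f x 0 i * g x 0 j *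
      'd (fun y => 'd h y (delta_mx 0 j)) x (delta_mx 0 i).
  apply: eq_bigr => i _; apply: eq_bigr => j _.
  rewrite [X in X * _]mulrC.
  exact: (congr1 (fun z => f x 0 i * g x 0 j * z) (schwarz x _ _ hs)).
rewrite opprD addrACA subrr add0r lieDE -sumrB; apply: eq_bigr => i _.
by rewrite lie_bracket_coord // mulrC mulrBr.
Qed.

End Brackets.

(** * Truncated power series and their operators *)

Section Jets.
Variables (R : realType) (d n : nat).
Local Notation V := 'rV[R]_d.

(** A jet is a polynomial in T of degree at most n with smooth functions as
    coefficients; operators between jets form the algebra in which the formal
    computation takes place. *)
Definition jet_pred : pred (nat -> V -> R) := fun eta =>
  `[< (forall k, smoothr (eta k)) /\ (forall k, (n < k)%N -> eta k = cst 0) >].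

Record jet := Jet { jet_val :> nat -> V -> R; _ : jet_pred jet_val }.
HB.instance Definition _ := [isSub for jet_val].
HB.instance Definition _ := [Choice of jet by <:].

Lemma jet_pred_submod : GRing.subsemimod_closed jet_pred.
Proof.
split; first split.
- apply/asboolP; split=> // k; exact: smoothr_cst.
- move=> e1 e2 /asboolP[s1 t1] /asboolP[s2 t2]; apply/asboolP; split=> k.
    exact: smoothrD (s1 k) (s2 k).
  move=> nk; apply/funext => x.
  by rewrite -[LHS]/(e1 k x + e2 k x) t1 // t2 //= addr0.
- move=> a e /asboolP[s t]; apply/asboolP; split=> k.
    exact: smoothrZ (s k).
  by move=> nk; apply/funext => x; rewrite -[LHS]/(a * e k x) t //= mulr0.
Qed.

HB.instance Definition _ :=
  GRing.SubChoice_isSubLmodule.Build R (nat -> V -> R) jet_pred jet jet_pred_submod.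

Definition endo_pred : pred (jet -> jet) := fun A => `[< linear A >].
Record endo := Endo { endo_val :> jet -> jet; _ : endo_pred endo_val }.
HB.instance Definition _ := [isSub for endo_val].
HB.instance Definition _ := [Choice of endo by <:].

Lemma endo_pred_submod : GRing.subsemimod_closed endo_pred.
Proof.
split; first split.
- by apply/asboolP => a u v; rewrite /= scaler0 addr0.
- move=> A B /asboolP lA /asboolP lB; apply/asboolP => a u v.
  rewrite -![(A + B) _]/(A _ + B _) lA lB scalerDr; exact: addrACA.
- move=> b A /asboolP lA; apply/asboolP => a u v.
  by rewrite -![(b *: A) _]/(b *: A _) lA scalerDr !scalerA mulrC.
Qed.

HB.instance Definition _ :=
  GRing.SubChoice_isSubLmodule.Build R (jet -> jet) endo_pred endo endo_pred_submod.

Lemma endoP (A B : endo) : (forall e, A e = B e) -> A = B.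
Proof. by move=> AB; apply/val_inj/funext. Qed.

Lemma endo_linear (A : endo) : linear A.
Proof. by case: A => A /= /asboolP. Qed.

Lemma endo_comp_subproof (A B : endo) : endo_pred (A \o B).
Proof. by apply/asboolP => a u v /=; rewrite !endo_linear. Qed.

Lemma endo_id_subproof : endo_pred id.
Proof. by apply/asboolP. Qed.

Definition endo_mul (A B : endo) := Endo (endo_comp_subproof A B).
Definition endo_one := Endo endo_id_subproof.

Lemma endo_add0 (A : endo) : A 0 = 0.
Proof.
have := endo_linear A 1 0 0; rewrite !scale1r addr0 => /eqP.
by rewrite -{1}[A 0]addr0 (inj_eq (addrI _)) eq_sym => /eqP.
Qed.

Fact endo_mulA : associative endo_mul. Proof. by move=> A B C; apply: endoP. Qed.
Fact endo_mul1 : left_id endo_one endo_mul. Proof. by move=> A; apply: endoP. Qed.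
Fact endo_mulr1 : right_id endo_one endo_mul. Proof. by move=> A; apply: endoP. Qed.
Fact endo_mulDl : left_distributive endo_mul +%R.
Proof. by move=> A B C; apply: endoP. Qed.
Fact endo_mulDr : right_distributive endo_mul +%R.
Proof.
move=> A B C; apply: endoP => e.
have := endo_linear A 1 (B e) (C e); rewrite !scale1r; exact.
Qed.
(** The monomial h T^m. *)
Definition homog_fun m (h : V -> R) k : V -> R :=
  if (k == m) && (m <= n)%N then h else cst 0.

Lemma homog_subproof m h : smoothr h -> jet_pred (homog_fun m h).
Proof.
move=> hs; apply/asboolP; split=> k; rewrite /homog_fun.
  by case: ifP => _ //; exact: smoothr_cst.
by move=> nk; case: eqP => //= km; rewrite -km leqNgt nk.
Qed.

Definition homog m h (hs : smoothr h) : jet := Jet (homog_subproof m hs).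

Fact endo_nz : endo_one != 0.
Proof.
apply/eqP => /(congr1 (fun A : endo => A (homog 0 (smoothr_cst 1)) 0%N 0)) /=.
by rewrite /homog_fun /= => /eqP; rewrite oner_eq0.
Qed.

HB.instance Definition _ := GRing.Zmodule_isNzRing.Build endo
  endo_mulA endo_mul1 endo_mulr1 endo_mulDl endo_mulDr endo_nz.

Fact endo_scaleAl a (A B : endo) : a *: (A * B) = (a *: A) * B.
Proof. by apply: endoP. Qed.
HB.instance Definition _ := GRing.Lmodule_isLalgebra.Build R endo endo_scaleAl.

Fact endo_scaleAr a (A B : endo) : a *: (A * B) = A * (a *: B).
Proof.
apply: endoP => e; have := endo_linear A a (B e) 0.
by rewrite !addr0 endo_add0 addr0 => /esym.
Qed.
HB.instance Definition _ := GRing.Lalgebra_isAlgebra.Build R endo endo_scaleAr.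

Lemma jetP (e e' : jet) : (forall k, (k <= n)%N -> e k = e' k) -> e = e'.
Proof.
move=> ee; apply: val_inj; apply/funext => k.
case: (leqP k n) => kn; first exact: ee.
by case: e e' {ee} => [e /= /asboolP[_ te]] [e' /= /asboolP[_ te']]; rewrite te // te'.
Qed.

Lemma jet_smooth (e : jet) k : smoothr (e k).
Proof. by case: e => e /= /asboolP[]. Qed.

Lemma jet_big (e : jet) k : (n < k)%N -> e k = cst 0.
Proof. by case: e => e /= /asboolP[_]; apply. Qed.

Lemma jetD (e e' : jet) k : (e + e') k = e k \+ e' k. Proof. by []. Qed.
Lemma jetDx (e e' : jet) k x : (e + e') k x = e k x + e' k x. Proof. by []. Qed.
Lemma jetZ a (e : jet) k : (a *: e) k = a \*: e k. Proof. by []. Qed.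
Lemma jetN (e : jet) k x : (- e) k x = - e k x. Proof. by []. Qed.
Lemma jet0 k : (0 : jet) k = cst 0. Proof. by []. Qed.

Lemma endoD (A B : endo) e : (A + B) e = A e + B e. Proof. by []. Qed.
Lemma endoZ a (A : endo) e : (a *: A) e = a *: A e. Proof. by []. Qed.
Lemma endoM (A B : endo) e : (A * B) e = A (B e). Proof. by []. Qed.
Lemma endoN (A : endo) e : (- A) e = - A e. Proof. by []. Qed.
Lemma endo_addr (A : endo) e e' : A (e + e') = A e + A e'.
Proof. by have := endo_linear A 1 e e'; rewrite !scale1r. Qed.
Lemma endo_scaler (A : endo) a e : A (a *: e) = a *: A e.
Proof. by have := endo_linear A a e 0; rewrite endo_add0 !addr0. Qed.

(** The operator T^m L_f. *)
Section GradedOperator.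
Variables (m : nat) (f : V -> V) (fs : vsmooth f).

Definition lie_op_fun (e : nat -> V -> R) k : V -> R :=
  if (m <= k <= n)%N then lieD f (e (k - m)%N) else cst 0.

Lemma lie_op_subproof (e : jet) : jet_pred (lie_op_fun e).
Proof.
apply/asboolP; split=> k; rewrite /lie_op_fun.
  case: ifP => _; last exact: smoothr_cst.
  by apply: smoothr_lieD => //; exact: jet_smooth.
by move=> nk; rewrite [(k <= n)%N]leqNgt nk andbF.
Qed.

Lemma lie_op_linear : endo_pred (fun e => Jet (lie_op_subproof e)).
Proof.
apply/asboolP => a u v; apply: jetP => k kn.
rewrite -[LHS]/(lie_op_fun (a *: u + v) k) -[RHS]/(a \*: lie_op_fun u k \+ lie_op_fun v k).
rewrite /lie_op_fun kn andbT; case: (m <= k)%N.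
  rewrite jetD jetZ lieDD ?lieDZ //; try exact: jet_smooth.
  by apply: smoothrZ; exact: jet_smooth.
by apply/funext => x; rewrite -[RHS]/(a * 0 + 0) mulr0 addr0.
Qed.

Definition lie_op : endo := Endo lie_op_linear.

Lemma lie_opE (e : jet) k : lie_op e k =
  if (m <= k <= n)%N then lieD f (e (k - m)%N) else cst 0.
Proof. by []. Qed.

End GradedOperator.

Lemma eq_lie_op m m' f g (fs : vsmooth f) (gs : vsmooth g) :
  m = m' -> f = g -> lie_op m fs = lie_op m' gs.
Proof.
move=> mm fg; case: m' / mm; case: g / fg gs => gs; apply: endoP => e.
by apply: jetP => k _; rewrite !lie_opE.
Qed.

Lemma lie_op0 m f (fs : vsmooth f) : (forall x, f x = 0) -> lie_op m fs = 0.
Proof.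
move=> f0; apply: endoP => e; apply: jetP => k _; rewrite lie_opE jet0.
by case: ifP => // _; apply/funext => x; rewrite /lieD f0 linear0.
Qed.

Lemma lie_opD m f g (fs : vsmooth f) (gs : vsmooth g) (fgs : vsmooth (f \+ g)) :
  lie_op m fgs = lie_op m fs + lie_op m gs.
Proof.
apply: endoP => e; apply: jetP => k kn; rewrite endoD jetD !lie_opE kn andbT.
case: ifP => _; last by apply/funext => x; rewrite /= addr0.
by apply/funext => x; rewrite /lieD /= linearD.
Qed.

(** Graded operators multiply degrees, and f |-> L_f is a morphism of Lie
    algebras. *)
Lemma lie_op_comm m m' f g (fs : vsmooth f) (gs : vsmooth g)
    (fgs : vsmooth (lie_bracket f g)) :
  comm (lie_op m fs) (lie_op m' gs) = lie_op (m + m') fgs.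
Proof.
apply: endoP => e; apply: jetP => k kn; apply/funext => x.
rewrite /comm endoD endoN jetDx jetN !endoM.
have two p p' f' g' (f's : vsmooth f') (g's : vsmooth g') :
    lie_op p f's (lie_op p' g's e) k x =
    if (p + p' <= k)%N then lieD f' (lieD g' (e (k - (p + p'))%N)) x else 0.
  rewrite !lie_opE kn andbT; case: leqP => pk; last by rewrite ifN // -ltnNge ltn_addr.
  rewrite (leq_trans (leq_subr _ _) kn) andbT leq_subRL // subnDA.
  by case: ifP => // _; rewrite lieD0.
rewrite !two lie_opE kn andbT (addnC m'); case: ifP => _; last by rewrite subr0.
by rewrite (lieD_bracket fs gs (jet_smooth e _)).
Qed.

(** A raises the order in T by at least k. *)
Definition order_ge k (A : endo) : Prop := forall (e : jet) j,
  (forall i, (i < j)%N -> e i = cst 0) ->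
  forall i, (i < j + k)%N -> A e i = cst 0.

Lemma order_filtered : filtered n order_ge.
Proof.
split.
- move=> k A B FA FB e j ej i ij; rewrite endoD jetD (FA e j) // (FB e j) //.
  by apply/funext => x; rewrite /= addr0.
- move=> k a A FA e j ej i ij; rewrite endoZ jetZ (FA e j) //.
  by apply/funext => x; rewrite -[LHS]/(a * 0) mulr0.
- move=> i j A B FA FB e m em l lm; rewrite endoM.
  apply: (FA _ (m + j)%N); last by rewrite -addnA [(j + i)%N]addnC.
  exact: FB em.
- move=> i j A ij FA e m em l lm; apply: (FA e m em).
  by apply: leq_trans lm _; rewrite leq_add2l.
- by [].
- by move=> e j ej i; rewrite addn0; exact: ej.
- move=> A FA; apply: endoP => e; apply: jetP => k kn.
  by apply: (FA e 0%N).
Qed.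

Lemma order_lie_op m f (fs : vsmooth f) : order_ge m (lie_op m fs).
Proof.
move=> e j ej i ij; rewrite lie_opE; case: ifP => // /andP[mi _].
by rewrite ej ?lieD0 //; lia.
Qed.

(** The Euler operator T d/dT. *)
Definition euler_fun (e : nat -> V -> R) k : V -> R := k%:R \*: e k.

Lemma euler_subproof (e : jet) : jet_pred (euler_fun e).
Proof.
apply/asboolP; split=> k; first by apply: smoothrZ; exact: jet_smooth.
by move=> nk; rewrite /euler_fun jet_big //; apply/funext => x; rewrite -[LHS]/(k%:R * 0) mulr0.
Qed.

Lemma euler_linear : endo_pred (fun e => Jet (euler_subproof e)).
Proof.
apply/asboolP => a u v; apply: jetP => k kn; apply/funext => x.
rewrite -[LHS]/(k%:R * (a * u k x + v k x)) -[RHS]/(a * (k%:R * u k x) + k%:R * v k x).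
by ring.
Qed.

Definition euler : endo := Endo euler_linear.

Lemma eulerE (e : jet) k : euler e k = k%:R \*: e k. Proof. by []. Qed.

Lemma eulerEx (e : jet) k x : euler e k x = k%:R * e k x. Proof. by []. Qed.

Lemma comm_euler_lie_op f (fs : vsmooth f) : comm euler (lie_op 1 fs) = lie_op 1 fs.
Proof.
apply: endoP => e; apply: jetP => k kn; apply/funext => x.
rewrite /comm endoD endoN jetDx jetN !endoM eulerEx !lie_opE kn andbT.
case: k kn => [|k] kn; first by rewrite -[LHS]/(0 * 0 - 0) mulr0 subr0.
rewrite [(_ <= k.+1)%N]/= subn1 [k.+1.-1]/= eulerE lieDZ; last exact: jet_smooth.
rewrite -[X in _ - X]/(k%:R * _).
by rewrite -mulrBl -natr1 addrAC subrr add0r mul1r.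
Qed.

(** An operator that commutes with T d/dT preserves the degree in T; if it
    also raises the order it kills every monomial h T^m, hence every jet. *)
Lemma euler_inj (A : endo) : order_ge 1 A -> comm euler A = 0 -> A = 0.
Proof.
move=> FA cA; apply: endoP => e.
have hom m h (hs : smoothr h) : A (homog m hs) = 0.
  set e' := homog m hs.
  have De : euler e' = m%:R *: e'.
    apply: jetP => k _; rewrite eulerE jetZ /= /homog_fun.
    case: eqP => [->|_] //=; apply/funext => x.
    by rewrite -[LHS]/(k%:R * 0) -[RHS]/(m%:R * 0) !mulr0.
  have DA : euler (A e') = m%:R *: A e'.
    have : comm euler A e' = 0 by rewrite cA.
    by rewrite /comm endoD endoN !endoM De endo_scaler => /eqP; rewrite subr_eq0 => /eqP.
  apply: jetP => k kn; case: (ltngtP k m) => [km|mk|km].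
  - apply: (FA e' m); last by rewrite addn1 ltnW.
    by move=> i im; rewrite /= /homog_fun ltn_eqF.
  - apply/funext => x; have := congr1 (fun z : jet => z k x) DA.
    rewrite eulerE jetZ /= => /eqP; rewrite -subr_eq0 -mulrBl mulf_eq0 subr_eq0.
    by rewrite eqr_nat gtn_eqF //= => /eqP.
  - apply: (FA e' m); last by rewrite addn1 km.
    by move=> i im; rewrite /= /homog_fun ltn_eqF.
(* Descending induction on the order of the jet, removing its leading
   monomial. *)
have gen m (u : jet) : (n.+1 - m <= n.+1)%N -> (forall i, (i < n.+1 - m)%N -> u i = cst 0) -> A u = 0.
  elim: m u => [|m IH] u _ u0.
    have -> : u = 0 by apply: jetP => k kn; apply: u0; rewrite subn0 ltnS.
    exact: endo_add0.
  set l := (n.+1 - m.+1)%N in u0.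
  have -> : u = (u - homog l (jet_smooth u l)) + homog l (jet_smooth u l) by rewrite subrK.
  rewrite endo_addr hom addr0; apply: IH; first exact: leq_subr.
  move=> i il; apply/funext => x; rewrite jetDx jetN /= /homog_fun.
  case: eqP => [->|/eqP il'] /=.
    case: (leqP l n) => /= ln; first by rewrite subrr.
    by rewrite jet_big //= subr0.
  by rewrite u0 ?subr0 //; move: il; rewrite /l in il' *; lia.
apply: (gen n.+1 e); rewrite subnn //.
Qed.
End Jets.

(** * Taylor expansion along flows *)

Section Flows.
Context {R : realType} {d : nat}.
Local Notation V := 'rV[R]_d.
Implicit Types (h : V -> R) (g : V -> V) (x u v : V) (phi : R -> V) (t s : R).

Lemma coord_le_norm v i : `|v 0 i| <= `|v|.
Proof.
rewrite [leRHS]mx_normrE.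
exact: (le_bigmax _ (fun j : 'I_1 * 'I_d => `|v j.1 j.2|) (0, i)).
Qed.

Lemma norm_le_coord v M : 0 <= M -> (forall i, `|v 0 i| <= M) -> `|v| <= M.
Proof.
move=> M0 vM; rewrite [leLHS]mx_normrE; apply: bigmax_le => // -[i j] _ /=.
by rewrite (ord1 i).
Qed.

(** The scalar c, which will be beta T or alpha T, is kept apart from the
    field so as to get bounds that are uniform in c. *)
Definition solution (c : R) g phi := forall t : R, 0 <= t <= 1 ->
  is_derive t (1 : R) phi (c *: g (phi t)).

Lemma solution_continuous c g phi t : solution c g phi -> 0 <= t <= 1 ->
  {for t, continuous phi}.
Proof.
move=> sol t01; have [pd _] := sol t t01.
by apply: differentiable_continuous; apply/derivable1_diffP.
Qed.

Lemma solution_derive c g phi h t : solution c g phi -> smoothr h -> 0 <= t <= 1 ->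
  is_derive t (1 : R) (h \o phi) (c * lieD g h (phi t)).
Proof.
move=> sol hs t01.
have := is_derive_curve (smoothr_diff (phi t) hs) (sol t t01).
by rewrite linearZ.
Qed.

Lemma MVT_bound (f df : R -> R) (b M : R) : 0 <= b -> b <= 1 ->
  (forall t : R, 0 <= t <= 1 -> is_derive t (1 : R) f (df t)) ->
  (forall t, 0 <= t -> t < b -> `|df t| <= M) -> `|f b - f 0| <= M * b.
Proof.
rewrite le_eqVlt => /orP[/eqP <- _ _ _|b0 b1 der bd]; first by rewrite subrr normr0 mulr0.
have cont : {within `[0, b], continuous f}.
  apply: derivable_within_continuous => t; rewrite in_itv /= => /andP[t0 tb].
  by case: (der t); rewrite ?t0 ?(le_trans tb).
have [|c cI e] := @MVT _ f df 0 b b0 _ cont.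
  move=> t; rewrite in_itv /= => /andP[t0 tb]; apply: der.
  by rewrite (ltW t0) (le_trans (ltW tb)).
move: cI; rewrite in_itv /= => /andP[c0 cb].
by rewrite e subr0 normrM (ger0_norm (ltW b0)) ler_wpM2r // ?bd ?ltW.
Qed.

Lemma locally_bounded (h : V -> R) x : {for x, continuous h} ->
  exists K r, [/\ 0 < K, 0 < r & forall y, `|y - x| < r -> `|h y| <= K].
Proof.
move=> hc; have /cvgrPdist_lt /(_ 1 ltr01) /nbhs_normP[r /= r0 H] := hc.
exists (`|h x| + 1), r; split=> // y yx.
have /= := H y; rewrite /ball_ /= distrC => /(_ yx) hy.
rewrite -[h y](subKr (h x)); apply: le_trans (ler_normB _ _) _.
by rewrite lerD2l ltW.
Qed.

Lemma norm_continuous_field g x : vsmooth g -> {for x, continuous (fun y => `|g y|)}.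
Proof.
move=> gs; apply: (@continuous_comp _ _ _ g (fun z => `|z|)).
  by apply: differentiable_continuous; exact: vsmooth_diff.
exact: norm_continuous.
Qed.

(** Solutions exist on [0, 1] by assumption, but nothing says a priori that
    they stay where the field is bounded.  Before the first exit time from a
    small ball the field is bounded by K, so the displacement is at most
    |c| K: for c small the exit never takes place. *)
Lemma flow_stays g x (e : R) : vsmooth g -> 0 < e ->
  exists2 r, 0 < r & forall c phi, `|c| < r -> solution c g phi ->
    `|phi 0 - x| < r -> forall s, 0 <= s <= 1 -> `|phi s - x| < e.
Proof.
move=> gs e0.
have [K [r0 [K0 r00 bd]]] := locally_bounded (@norm_continuous_field g x gs).
pose r := Num.min e r0.
have rp : 0 < r by rewrite lt_min e0.
pose r1 := Num.min (r / 2) (r / 2 / K).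
exists r1; first by rewrite lt_min !divr_gt0.
move=> c phi cr sol ur.
suff main s : 0 <= s <= 1 -> `|phi s - x| < r.
  by move=> s s01; have := main s s01; rewrite lt_min => /andP[].
move=> s01; rewrite ltNge; apply/negP => bad.
have small y : `|y - x| < r -> `|g y| <= K.
  by rewrite lt_min => /andP[_ /bd]; rewrite normr_id.
have u2 : `|phi 0 - x| < r / 2 by apply: lt_le_trans ur _; rewrite ge_min lexx.
have ck : `|c| * K <= r / 2.
  rewrite -ler_pdivlMr //; apply: ltW; apply: lt_le_trans cr _.
  by rewrite ge_min lexx orbT.
pose S := [set t : R | 0 <= t <= 1 /\ r <= `|phi t - x|].
have S0 : S !=set0 by exists s; split.
have lbS : has_lbound S by exists 0 => t [/andP[]].
have iS : has_inf S by split.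
set b := inf S.
have b0 : 0 <= b by apply: lb_le_inf => // t [/andP[]].
have b1 : b <= 1 by apply: le_trans (ge_inf lbS (_ : S s)) _; [split|case/andP: s01].
have b01 : 0 <= b <= 1 by rewrite b0.
(* b is the first exit time: the solution is inside before b, and outside
   at b by continuity. *)
have before t : 0 <= t -> t < b -> `|phi t - x| < r.
  move=> t0 tb; rewrite ltNge; apply/negP => rt.
  have : b <= t by apply: ge_inf => //; split => //; rewrite t0 (le_trans (ltW tb)).
  by rewrite leNgt tb.
have atb : r <= `|phi b - x|.
  rewrite leNgt; apply/negP => lt.
  have dc : {for b, continuous (fun t => `|phi t - x|)}.
    apply: (@continuous_comp _ _ _ (fun t => phi t - x) (fun z => `|z|)); last exact: norm_continuous.
    by apply: cvgB; [exact: (solution_continuous sol b01)|exact: cvg_cst].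
  have gap : 0 < r - `|phi b - x| by rewrite subr_gt0.
  have /cvgrPdist_lt /(_ _ gap) /nbhs_normP[w /= w0 H] := dc.
  have [t St tw] := inf_adherent w0 iS.
  have bt : b <= t by exact: ge_inf.
  have /= := H t; rewrite /ball_ /= distrC ger0_norm ?subr_ge0 // ltrBlDl => /(_ tw).
  rewrite ltr_norml => /andP[h _].
  by case: St => _; rewrite leNgt => /negP; apply; lra.
have : `|phi b - phi 0| <= r / 2.
  apply: norm_le_coord; first by rewrite divr_ge0 // ltW.
  move=> i.
  have := @MVT_bound (coordr i \o phi) (fun t => c * lieD g (coordr i) (phi t)) b (r / 2) b0 b1 _ _.
  rewrite /= /coordr !mxE => H; apply: le_trans (H _ _) _.
  - by move=> t t01; apply: solution_derive => //; exact: smoothr_coord.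
  - move=> t t0 tb; apply: le_trans ck; rewrite normrM ler_wpM2l //.
    rewrite /lieD diff_coordr; apply: le_trans (coord_le_norm _ _) _.
    by apply: small; apply: before.
  - by rewrite ler_piMr // divr_ge0 // ltW.
move=> h; have : `|phi b - x| < r.
  rewrite -[phi b](subrK (phi 0)) -addrA; apply: le_lt_trans (ler_normD _ _) _.
  by rewrite [r]splitr ler_ltD.
by rewrite ltNge atb.
Qed.

End Flows.

Section Expansion.
Context {R : realType} {d : nat}.
Local Notation V := 'rV[R]_d.
Implicit Types (h : V -> R) (g : V -> V) (x u v : V) (phi : R -> V) (t s : R).

Definition taylor n (c : R) (a : nat -> R) : {poly R} :=
  \sum_(k < n) (tpow c k * a k) *: 'X^k.

Lemma deriv_taylor n c a :
  (taylor n.+1 c a)^`() = c *: taylor n c (fun k => a k.+1).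
Proof.
rewrite /taylor big_ord_recl derivD expr0 derivZ -polyC1 derivC scaler0 add0r.
rewrite raddf_sum scaler_sumr; apply: eq_bigr => k _.
rewrite lift0 -[LHS]/((_ *: _)^`()) derivZ derivXn /= -scalerMnr scalerMnl scalerA; congr (_ *: _).
rewrite /tpow exprS factSV -mulr_natr.
move: (mulVf (@factS_neq0 R k).1); move: (k.+1%:R) (k`!%:R^-1) => p q pV.
by rewrite -[RHS]mul1r -pV; ring.
Qed.

Lemma taylor_at0 n c a : (taylor n.+1 c a).[0] = a 0%N.
Proof.
rewrite /taylor big_ord_recl hornerD hornerZ expr0 hornerC mulr1 tpow0r mul1r.
rewrite horner_sum big1 ?addr0 // => k _.
by rewrite hornerZ hornerXn expr0n mulr0.
Qed.

Lemma taylor_at1 n c a : (taylor n c a).[1] = \sum_(k < n) tpow c k * a k.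
Proof.
rewrite /taylor horner_sum; apply: eq_bigr => k _.
by rewrite hornerZ hornerXn expr1n mulr1.
Qed.

(** Induction on n: the derivative of the remainder of order n+1 of h is c
    times the remainder of order n of L_g h. *)
Lemma flow_taylor c g phi n h K : vsmooth g -> solution c g phi -> smoothr h ->
  (forall s, 0 <= s <= 1 -> `|iter n (lieD g) h (phi s)| <= K) ->
  forall s, 0 <= s <= 1 ->
  `|h (phi s) - (taylor n c (fun k => iter k (lieD g) h (phi 0))).[s]| <= K * `|c| ^+ n.
Proof.
move=> gs sol; elim: n h => [|n IH] h hs bd s s01.
  by rewrite /taylor big_ord0 horner0 subr0 expr0 mulr1; exact: bd.
have K0 : 0 <= K by apply: le_trans (bd s s01).
have {}IH := IH (lieD g h) (smoothr_lieD gs hs).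
set p := taylor _ _ _; pose f := (h \o phi) - horner p.
pose df t := c * (lieD g h (phi t) -
  (taylor n c (fun k => iter k (lieD g) (lieD g h) (phi 0))).[t]).
have f0 : f 0 = 0.
  by rewrite -[LHS]/(h (phi 0) - p.[0]) taylor_at0 subrr.
rewrite -[_ - _]/(f s) -[f s]subr0 -f0.
have [s0 s1] := andP s01.
apply: (@le_trans _ _ (K * `|c| ^+ n.+1 * s)); last first.
  by rewrite ler_piMr // mulr_ge0 // exprn_ge0.
apply: (@MVT_bound _ f df) => // [t t01|t t0 ts].
  have d1 := solution_derive sol hs t01.
  have d2 : is_derive t (1 : R) (horner p) p^`().[t] := is_derive_poly p t.
  have := is_deriveB d1 d2; rewrite deriv_taylor hornerZ -mulrBr.
  by under [X in taylor _ _ X]eq_fun do rewrite iterSr.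
rewrite /df normrM exprS mulrCA ler_wpM2l //; apply: IH.
  by move=> r r01; have := bd r r01; rewrite iterSr.
by rewrite t0 (le_trans (ltW ts)).
Qed.

Lemma exp_flow_solution c g u v : exp_flow (c \*: g) u v ->
  exists phi, [/\ solution c g phi, phi 0 = u & phi 1 = v].
Proof. by move=> [phi [p0 sol p1]]; exists phi. Qed.

Lemma flow_close (b : R) g x (e : R) : vsmooth g -> 0 < e ->
  exists2 r, 0 < r & forall T u v, 0 < T < r -> `|u - x| < r ->
    exp_flow ((b * T) \*: g) u v -> `|v - x| < e.
Proof.
move=> gs e0; have [r r0 H] := flow_stays x gs e0.
have n0 : 0 < 1 + `|b| by rewrite ltr_pwDl.
exists (Num.min r (r / (1 + `|b|))); first by rewrite lt_min r0 divr_gt0.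
move=> T u v /andP[T0]; rewrite !lt_min => /andP[_ Tr] /andP[ux _].
move=> /exp_flow_solution[phi [sol p0 p1]]; rewrite -p1.
apply: (H (b * T)) => //; rewrite ?p0 // ?ler01 ?lexx //.
rewrite normrM (gtr0_norm T0) mulrC.
move: Tr; rewrite ltr_pdivlMr //; apply: le_lt_trans.
by rewrite ler_wpM2l ?(ltW T0) ?lerDr.
Qed.

Lemma iter_lieD_smooth g h k : vsmooth g -> smoothr h -> smoothr (iter k (lieD g) h).
Proof. by move=> gs hs; elim: k => //= k IH; exact: smoothr_lieD. Qed.

(** The constants depend on the base point x only, not on the starting point
    u, which allows flows to be composed. *)
Lemma flow_expand (b : R) g x n h : vsmooth g -> smoothr h ->
  exists C r, [/\ 0 <= C, 0 < r & forall T u v, 0 < T < r -> `|u - x| < r ->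
    exp_flow ((b * T) \*: g) u v ->
    `|h v - \sum_(k < n) tpow (b * T) k * iter k (lieD g) h u| <= C * T ^+ n].
Proof.
move=> gs hs; have ks := iter_lieD_smooth n gs hs.
have kc : {for x, continuous (iter n (lieD g) h)} by apply: smoothr_continuous.
have [K [r [K0 r0 bd]]] := locally_bounded kc.
have [r1 r10 H] := flow_stays x gs r0.
have n0 : 0 < 1 + `|b| by rewrite ltr_pwDl.
exists (K * `|b| ^+ n), (Num.min r1 (r1 / (1 + `|b|))).
split; first by rewrite mulr_ge0 ?exprn_ge0 // ltW.
  by rewrite lt_min r10 divr_gt0.
move=> T u v /andP[T0]; rewrite !lt_min => /andP[_ Tr] /andP[ux _].
move=> /exp_flow_solution[phi [sol p0 p1]].
have cT : `|b * T| < r1.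
  rewrite normrM (gtr0_norm T0) mulrC.
  move: Tr; rewrite ltr_pdivlMr //; apply: le_lt_trans.
  by rewrite ler_wpM2l ?(ltW T0) ?lerDr.
have near s : 0 <= s <= 1 -> `|phi s - x| < r.
  by move=> s01; apply: (H (b * T)) => //; rewrite p0.
have h1 : 0 <= (1 : R) <= 1 by rewrite ler01 /=.
have := @flow_taylor _ _ _ n h K gs sol hs (fun s s01 => bd _ (near s s01)) 1 h1.
by rewrite taylor_at1 p0 p1 normrM (gtr0_norm T0) exprMn mulrA.
Qed.

Variable n : nat.
Local Notation jet := (jet R d n).
Local Notation endo := (endo R d n).

Definition jet_eval (e : jet) (T : R) (x : V) : R := \sum_(k < n.+1) T ^+ k * e k x.

Lemma lie_op_exp g (gs : vsmooth g) (e : jet) j k : (k <= n)%N ->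
  (lie_op n 1 gs ^+ j) e k = if (j <= k)%N then iter j (lieD g) (e (k - j)%N) else cst 0.
Proof.
elim: j k => [|j IH] k kn; first by rewrite expr0 /= subn0.
rewrite exprS endoM lie_opE kn andbT; case: k kn => [|k] kn; first exact: erefl.
rewrite /= subn1 /= IH ?(ltnW kn) // ltnS subSS.
by case: ifP => // _; rewrite lieD0.
Qed.

Lemma endo_sum (I : Type) (r : seq I) (F : I -> endo) (e : jet) k x :
  (\sum_(i <- r) F i) e k x = \sum_(i <- r) F i e k x.
Proof.
elim: r => [|i r IH]; first by rewrite !big_nil.
by rewrite !big_cons endoD jetDx IH.
Qed.

Lemma jet_eval_exp g (gs : vsmooth g) (b T : R) (e : jet) u :
  jet_eval (nexp n (b *: lie_op n 1 gs) e) T u =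
  \sum_(k < n.+1) T ^+ k * \sum_(j < n.+1 - k) tpow (b * T) j * iter j (lieD g) (e k) u.
Proof.
pose f j k := if (j + k <= n)%N then
  T ^+ k * (tpow (b * T) j * iter j (lieD g) (e k) u) else 0.
transitivity (\sum_(m < n.+1) \sum_(j < m.+1) f j (m - j)%N).
  apply: eq_bigr => m _; have mn : (m <= n)%N by rewrite -ltnS.
  rewrite /nexp endo_sum mulr_sumr (big_ord_widen n.+1 (fun j => f j (m - j)%N)) //.
  rewrite [RHS]big_mkcond; apply: eq_bigr => j _.
  rewrite /dpow exprZn scalerA endoZ jetZ.
  rewrite -[X in _ * X]/(_ * ((lie_op n 1 gs ^+ j) e m u)).
  rewrite lie_op_exp // ltnS; case: ifP => jm; last by rewrite mulr0 mulr0.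
  rewrite /f subnKC // mn /tpow exprMn -[in LHS](subnK jm) exprD addnK.
  by ring.
rewrite sum_triangle; last by move=> i j nij; rewrite /f ifN // -ltnNge.
rewrite exchange_big /=; apply: eq_bigr => k _; rewrite mulr_sumr.
rewrite (big_ord_widen n.+1 (fun j => T ^+ k * (tpow (b * T) j * iter j (lieD g) (e k) u)));
  last exact: leq_subr.
rewrite [RHS]big_mkcond /=; apply: eq_bigr => j _; rewrite /f.
by rewrite (_ : (j + k <= n)%N = (j < n.+1 - k)%N) //; lia.
Qed.

(** Pullback by a flow is the exponential of the Lie derivative, modulo
    T^{n+1}: each coefficient of T^k is expanded to order n - k. *)
Lemma flow_jet (b : R) g (gs : vsmooth g) x (e : jet) :
  exists C r, [/\ 0 <= C, 0 < r & forall T u v, 0 < T < r -> `|u - x| < r ->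
    exp_flow ((b * T) \*: g) u v ->
    `|jet_eval e T v - jet_eval (nexp n (b *: lie_op n 1 gs) e) T u| <= C * T ^+ n.+1].
Proof.
pose D k T u v := e k v - \sum_(j < n.+1 - k) tpow (b * T) j * iter j (lieD g) (e k) u.
suff H m : (m <= n.+1)%N -> exists C r, [/\ 0 <= C, 0 < r &
    forall T u v, 0 < T < r -> `|u - x| < r -> exp_flow ((b * T) \*: g) u v ->
    `|\sum_(k < m) T ^+ k * D k T u v| <= C * T ^+ n.+1].
  have [C [r [C0 r0 H']]] := H n.+1 (leqnn _).
  exists C, r; split=> // T u v T0 ux uv.
  rewrite jet_eval_exp /jet_eval -sumrB.
  by under eq_bigr => k _ do rewrite -mulrBr; exact: H'.
elim: m => [|m IH] mn.
  exists 0, 1; split=> // T u v _ _ _; by rewrite big_ord0 normr0 mul0r.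
have [C1 [r1 [C10 r10 H1]]] := IH (ltnW mn).
have [C2 [r2 [C20 r20 H2]]] := @flow_expand b g x (n.+1 - m) (e m) gs (jet_smooth e m).
exists (C1 + C2), (Num.min r1 r2); split; [exact: addr_ge0|by rewrite lt_min r10|].
move=> T u v /andP[T0]; rewrite !lt_min => /andP[Tr1 Tr2] /andP[u1 u2] uv.
have T1 : 0 < T < r1 by rewrite T0.
have T2 : 0 < T < r2 by rewrite T0.
rewrite big_ord_recr /= mulrDl; apply: le_trans (ler_normD _ _) _.
apply: lerD; first exact: H1.
rewrite normrM (ger0_norm (exprn_ge0 _ (ltW T0))).
rewrite -[n.+1 in leRHS](subnKC (ltnW mn)) exprD mulrCA ler_wpM2l ?exprn_ge0 ?(ltW T0) //.
exact: (H2 T u v T2 u2 uv).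
Qed.

End Expansion.

(** * Expansion of the splitting method and the order conditions *)

Section SplittingExpansion.
Context {R : realType} {d : nat}.
Variable N : nat.
Local Notation n := N.*2.+1.
Local Notation V := 'rV[R]_d.
Variables (f0 f1 : V -> V) (f0s : vsmooth f0) (f1s : vsmooth f1).
Local Notation X := (lie_op n 1 f0s).
Local Notation Y := (lie_op n 1 f1s).
Local Notation jet := (jet R d n).

Lemma split_flow_close ab x0 (e : R) : 0 < e ->
  exists2 r, 0 < r & forall T z, 0 < T < r -> split_flow f0 f1 T ab x0 z -> `|z - x0| < e.
Proof.
elim: ab e => [|[a b] ab IH] e e0.
  by exists 1 => // T z _ /= ->; rewrite subrr normr0.
have [r1 r10 H1] := flow_close a x0 f0s e0.
have [r2 r20 H2] := flow_close b x0 f1s r10.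
have [r3 r30 H3] := IH _ r20.
exists (Num.min r1 (Num.min r2 r3)); first by rewrite !lt_min r10 r20.
move=> T z /andP[T0]; rewrite !lt_min => /and3P[T1 T2 T3] /= [u [v [uz uv vz]]].
apply: (H1 T v z _ _ vz); first by rewrite T0.
apply: (H2 T u v _ _ uv); first by rewrite T0.
by apply: H3 uz; rewrite T0.
Qed.

(** The last two flows are expanded first, which transforms the jet by the
    rightmost factors of [split_op]; then the induction hypothesis applies to
    the other flows. *)
Lemma split_flow_jet ab x0 (e : jet) :
  exists C r, [/\ 0 <= C, 0 < r & forall T z, 0 < T < r ->
    split_flow f0 f1 T ab x0 z ->
    `|jet_eval e T z - jet_eval (split_op N X Y ab e) T x0| <= C * T ^+ n.+1].
Proof.
elim: ab e => [|[a b] ab IH] e.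
  by exists 0, 1; split=> // T z _ /= ->; rewrite subrr normr0 mul0r.
have [C1 [r1 [C10 r10 H1]]] := flow_jet a f0s x0 e.
have [C2 [r2 [C20 r20 H2]]] := flow_jet b f1s x0 (nexp n (a *: X) e).
have [C3 [r3 [C30 r30 H3]]] := IH (nexp n (b *: Y) (nexp n (a *: X) e)).
have [r4 r40 H4] := flow_close b x0 f1s r10.
have r240 : 0 < Num.min r2 r4 by rewrite lt_min r20.
have [r5 r50 H5] := split_flow_close ab x0 r240.
exists (C1 + C2 + C3), (Num.min r1 (Num.min r2 (Num.min r3 (Num.min r4 r5)))).
split; [by rewrite !addr_ge0|by rewrite !lt_min r10 r20 r30 r40|].
move=> T z /andP[T0]; rewrite !lt_min => /and5P[T1 T2 T3 T4 T5] /= [u [v [uz uv vz]]].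
have : `|u - x0| < Num.min r2 r4 by apply: H5 uz; rewrite T0.
rewrite lt_min => /andP[u2 u4].
have v1 : `|v - x0| < r1 by apply: (H4 T u v _ u4 uv); rewrite T0.
have B1 := H1 T v z (introT andP (conj T0 T1)) v1 vz.
have B2 := H2 T u v (introT andP (conj T0 T2)) u2 uv.
have B3 := H3 T u (introT andP (conj T0 T3)) uz.
rewrite !mulrDl; apply: le_trans (lerD (lerD B1 B2) B3).
apply: le_trans (lerD (ler_normD _ _) (lexx _)); apply: le_trans (ler_normD _ _).
by rewrite !addrA !subrK.
Qed.

Lemma sum_flow_jet (f01s : vsmooth (f0 \+ f1)) x0 (e : jet) :
  exists C r, [/\ 0 <= C, 0 < r & forall T y, 0 < T < r ->
    exp_flow (T \*: (f0 \+ f1)) x0 y ->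
    `|jet_eval e T y - jet_eval (nexp n (X + Y) e) T x0| <= C * T ^+ n.+1].
Proof.
have [C [r [C0 r0 H]]] := flow_jet 1 f01s x0 e.
exists C, r; split=> // T y T0 xy.
have := H T x0 y T0; rewrite subrr normr0 mul1r scale1r lie_opD; exact.
Qed.

End SplittingExpansion.

(** The lowest nonzero coefficient would dominate for T small. *)
Lemma poly_small (R : realType) (m : nat) (a : nat -> R) (C r : R) : 0 < r ->
  (forall T, 0 < T < r -> `|\sum_(k < m) T ^+ k * a k| <= C * T ^+ m) ->
  forall k, (k < m)%N -> a k = 0.
Proof.
move=> r0 H k; have [l] := ubnP k; elim: l k => // l IH k; rewrite ltnS => kl km.
apply/eqP; apply: contraT => ak.
have low i : (i < k)%N -> a i = 0.
  by move=> ik; apply: IH; [exact: leq_trans kl|exact: ltn_trans km].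
pose M := C + \sum_(i < m) `|a i|.
have C0 : 0 <= C.
  have r2 : 0 < r / 2 < r by rewrite divr_gt0 // ltr_pdivrMr // ltr_pMr // ltr1n.
  have := le_trans (normr_ge0 _) (H _ r2).
  by rewrite pmulr_lge0 // exprn_gt0 //; case/andP: r2.
have M0 : 0 < 1 + M.
  by rewrite ltr_pwDl // /M addr_ge0 // sumr_ge0.
(* Small enough for the term of degree k to exceed all the others. *)
pose T := Num.min (1 / 2) (Num.min (r / 2) (`|a k| / (1 + M) / 2)).
have T0 : 0 < T by rewrite !lt_min !divr_gt0 ?normr_gt0.
have T1 : T <= 1.
  by rewrite ge_min (_ : 1 / 2 <= 1 = true) // ler_pdivrMr // mul1r ler1n.
have Tr : T < r.
  by rewrite !gt_min (_ : r / 2 < r = true) ?orbT // ltr_pdivrMr // ltr_pMr // ltr1n.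
have Ta : T * (1 + M) < `|a k|.
  rewrite -ltr_pdivlMr // !gt_min (_ : `|a k| / (1 + M) / 2 < `|a k| / (1 + M) = true) ?orbT //.
  by rewrite ltr_pdivrMr // ltr_pMr ?ltr1n // divr_gt0 // normr_gt0.
have := H T; rewrite T0 Tr => /(_ isT).
rewrite (bigD1 (Ordinal km)) //= => HT.
set S := \sum_(i < m | _) _ in HT.
have HS : `|S| <= T ^+ k.+1 * \sum_(i < m) `|a i|.
  apply: le_trans (ler_norm_sum _ _ _) _.
  rewrite mulr_sumr big_mkcond /=; apply: ler_sum => i _.
  case: ifP => [ik|_]; last by rewrite mulr_ge0 // exprn_ge0 // ltW.
  case: (ltnP i k) => [/low ->|ki].
    by rewrite mulr0 normr0 mulr_ge0 // exprn_ge0 // ltW.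
  rewrite normrM (ger0_norm (exprn_ge0 _ (ltW T0))) ler_wpM2r //.
  apply: ler_wiXn2l; rewrite ?(ltW T0) // ltn_neqAle ki andbT.
  by move: ik; rewrite -val_eqE /= eq_sym.
have HC : C * T ^+ m <= C * T ^+ k.+1.
  by rewrite ler_wpM2l //; apply: ler_wiXn2l; rewrite ?(ltW T0).
have : T ^+ k * `|a k| <= T ^+ k.+1 * M.
  have -> : T ^+ k * `|a k| = `|(T ^+ k * a k + S) - S|.
    by rewrite addrK normrM (ger0_norm (exprn_ge0 _ (ltW T0))).
  apply: le_trans (ler_normB _ _) _; rewrite /M mulrDr [T ^+ k.+1 * C]mulrC.
  by apply: lerD => //; exact: le_trans HC.
rewrite exprSr -mulrA ler_pM2l ?exprn_gt0 // leNgt => /negP; case.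
apply: le_lt_trans Ta; rewrite ler_wpM2l ?(ltW T0) // lerDr //.
Qed.

Lemma near_right (R : realType) (P : R -> Prop) :
  (\forall T \near (0 : R)^'+, P T) -> exists2 r, 0 < r & forall T, 0 < T < r -> P T.
Proof.
move=> /nbhs_normP[r /= r0 H]; exists r => // T /andP[T0 Tr]; apply: (H T) => //=.
by rewrite /ball_ /= sub0r normrN gtr0_norm.
Qed.

Section Obstruction.
Context {R : realType} {d : nat}.
Variables (N : nat) (N_gt0 : (0 < N)%N).
Local Notation n := N.*2.+1.
Local Notation V := 'rV[R]_d.
Variables (f0 f1 : V -> V) (f0s : vsmooth f0) (f1s : vsmooth f1).
Local Notation X := (lie_op n 1 f0s).
Local Notation Y := (lie_op n 1 f1s).

Lemma vsmooth_fM j : vsmooth (fM f0 f1 j).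
Proof. by elim: j => //= j IH; exact: vsmooth_lie_bracket. Qed.

Lemma vsmooth_fW j : vsmooth (fW f0 f1 j).
Proof. by apply: vsmooth_lie_bracket; exact: vsmooth_fM. Qed.

Lemma vsmooth_sum : vsmooth (f0 \+ f1).
Proof.
move=> i; have -> : (fun x => (f0 \+ f1) x 0 i) =
    (fun x => f0 x 0 i) \+ (fun x => f1 x 0 i) by apply/funext => x; rewrite /= mxE.
by apply: smoothrD; [exact: f0s | exact: f1s].
Qed.

Lemma iter_comm_lie_op j : iter_comm Y X j = lie_op n j.+1 (vsmooth_fM j).
Proof.
elim: j => [|j IH] /=; first exact: eq_lie_op.
by rewrite IH (@lie_op_comm _ _ _ _ _ _ _ _ _ (vsmooth_fM j.+1)); apply: eq_lie_op => //; rewrite addn1.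
Qed.

Lemma comm_lie_op_fW j : (0 < j)%N ->
  comm (iter_comm Y X j.-1) (iter_comm Y X j) = lie_op n j.*2.+1 (vsmooth_fW j).
Proof.
by move=> j0; rewrite !iter_comm_lie_op (@lie_op_comm _ _ _ _ _ _ _ _ _ (vsmooth_fW j)); apply: eq_lie_op => //; lia.
Qed.

Definition coord_jet i : jet R d n := homog n 0 (smoothr_coord (R := R) i).

Lemma lie_op_coord_jet m f (fs : vsmooth f) i x : (m <= n)%N -> lie_op n m fs (coord_jet i) m x = f x 0 i.
Proof.
move=> mn; rewrite lie_opE leqnn mn subnn.
by rewrite -[coord_jet i 0%N]/(homog_fun n 0 (coordr i) 0) /homog_fun /= /lieD diff_coordr.
Qed.

Lemma order_coord_jet m (A : endo R d n) i k x : order_ge m A -> (k < m)%N -> A (coord_jet i) k x = 0.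
Proof.
by move=> FA km; rewrite (FA _ 0%N).
Qed.

Lemma coord_jet_eval i T x : jet_eval (coord_jet i) T x = x 0 i.
Proof.
rewrite /jet_eval big_ord_recl expr0 mul1r big1 ?addr0 // => k _.
by rewrite [X in _ * X](_ : _ = 0) ?mulr0.
Qed.

(** The difference of the two expansions of a coordinate function is a
    polynomial in T that is O(T^{n+1}), hence zero. *)
Lemma order_condition (ab : seq (R * R)) : has_order f0 f1 ab n ->
  forall i k x, (split_op N X Y ab - nexp n (X + Y)) (coord_jet i) k x = 0.
Proof.
move=> H i k x; have [kn|nk] := ltnP k n.+1; last first.
  by rewrite jet_big.
have [C0 /near_right[r0 r00 H0]] := H x.
have [C1 [r1 [C10 r10 H1]]] := split_flow_jet f0s f1s ab x (coord_jet i).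
have [C2 [r2 [C20 r20 H2]]] := sum_flow_jet f0s f1s vsmooth_sum x (coord_jet i).
apply: (@poly_small R n.+1 (fun k => (split_op N X Y ab - nexp n (X + Y)) (coord_jet i) k x)
  (C0 + C1 + C2) (Num.min r0 (Num.min r1 r2))) => //; first by rewrite !lt_min r00 r10.
move=> T /andP[T0]; rewrite !lt_min => /and3P[T1 T2 T3].
have [|y [z [xy xz yz]]] := H0 T; first by rewrite T0.
have B1 := H1 T z (introT andP (conj T0 T2)) xz.
have B2 := H2 T y (introT andP (conj T0 T3)) xy.
have B0 : `|y 0 i - z 0 i| <= C0 * T ^+ n.+1.
  have -> : y 0 i - z 0 i = (y - z) 0 i by rewrite !mxE.
  exact: le_trans (coord_le_norm _ _) yz.
rewrite !coord_jet_eval in B1 B2.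
have -> : \sum_(k < n.+1) T ^+ k * (split_op N X Y ab - nexp n (X + Y)) (coord_jet i) k x =
  jet_eval (split_op N X Y ab (coord_jet i)) T x - jet_eval (nexp n (X + Y) (coord_jet i)) T x.
  rewrite /jet_eval -sumrB; apply: eq_bigr => j _.
  by rewrite endoD endoN jetDx jetN mulrBr.
set P := jet_eval _ T x in B1 *; set Q := jet_eval _ T x in B2 *.
have -> : P - Q = - (z 0 i - P) - (y 0 i - z 0 i) + (y 0 i - Q) by ring.
rewrite !mulrDl; apply: le_trans (ler_normD _ _) _; apply: lerD => //.
by apply: le_trans (ler_normB _ _) _; rewrite normrN addrC; apply: lerD.
Qed.

Lemma lie_bracket_proportional (f g : V -> V) c x : vsmooth f -> g = c \*: f ->
  lie_bracket f g x = 0 /\ lie_bracket g f x = 0.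
Proof.
move=> fs ->.
have e v : 'd (c \*: f) x v = c *: 'd f x v.
  exact: (congr1 (fun F => F v) (diffZ c (vsmooth_diff x fs))).
have l : 'd f x (c *: f x) = c *: 'd f x (f x) by exact: linearZ.
split; apply/eqP; rewrite subr_eq0; apply/eqP.
  exact: etrans (e (f x)) (esym l).
exact: etrans l (esym (e (f x))).
Qed.

Lemma fM_zero_from j k : (forall x, fM f0 f1 j x = 0) -> (j <= k)%N ->
  forall x, fM f0 f1 k x = 0.
Proof.
move=> j0; elim: k => [|k IH]; first by rewrite leqn0 => /eqP e; move: j0; rewrite e.
rewrite leq_eqVlt => /orP[/eqP e|]; first by move: j0; rewrite e.
rewrite ltnS => /IH k0 x /=.
apply: (lie_bracket_proportional x f0s (c := 0) _).2.
by apply/funext => y; rewrite k0 /= scale0r.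
Qed.

(** Two proportional fields commute. *)
Lemma fM1_dependent a b : (a, b) <> (0, 0) -> (forall x, a *: f0 x + b *: f1 x = 0) ->
  forall x, fM f0 f1 1 x = 0.
Proof.
move=> ab0 dep x /=.
have [a0|a0] := eqVneq a 0; last first.
  apply: (lie_bracket_proportional x f1s (c := - (a^-1 * b)) _).1.
  apply/funext => y; apply: (scalerI a0); rewrite /= scalerA mulrN mulrA divff // mul1r.
  by rewrite scaleNr; apply/eqP; rewrite -addr_eq0 dep.
have b0 : b != 0 by apply/eqP => b0; apply: ab0; rewrite a0 b0.
apply: (lie_bracket_proportional x f0s (c := 0) _).2.
apply/funext => y; apply: (scalerI b0); rewrite /= scale0r scaler0.
by have := dep y; rewrite a0 scale0r add0r.
Qed.

(** If the conclusion fails, no f_{M_j} vanishes for j <= 2N, since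
    f_{M_{j+1}} is a bracket with f_{M_j}.  The leading term of the error at
    each order is a multiple of such a field, and at the last order a
    combination of f_{M_{2N}} and f_{W_N}: all the coefficients vanish. *)
Lemma splitting_obstruction (ab : seq (R * R)) :
  (forall j, (1 <= j <= N - 1)%N -> forall x, fW f0 f1 j x = 0) ->
  all (fun p => 0 <= p.1) ab -> has_order f0 f1 ab n ->
  linearly_dependent2 (fM f0 f1 N.*2) (fW f0 f1 N).
Proof.
move=> W0 ab0 /order_condition err0.
apply: contrapT => indep.
have M0 j : (j <= N.*2)%N -> ~ (forall x, fM f0 f1 j x = 0).
  move=> jN /fM_zero_from /(_ jN) z; apply: indep; exists 1, 0; split.
    by case=> /eqP; rewrite oner_eq0.
  by move=> x; rewrite z scaler0 scale0r addr0.
have Wc j : (1 <= j <= N - 1)%N ->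
    comm (iter_comm Y X j.-1) (iter_comm Y X j) = 0.
  by move=> j1; rewrite comm_lie_op_fW ?lie_op0 //; [exact: W0|case/andP: j1].
have FX : order_ge 1 X by exact: order_lie_op.
have FY : order_ge 1 Y by exact: order_lie_op.
have F := order_filtered R d n.
have DX := comm_euler_lie_op n f0s.
have DY := comm_euler_lie_op n f1s.
have EI := @euler_inj R d n.
set err := split_op N X Y ab - _ in err0.
have lin := err_linear N_gt0 F FX FY Wc DX DY EI ab.
rewrite -/err in lin.
set sigma := \sum_(p <- ab) p.1 in lin; set mu := moment (nodes 0 ab) 0 in lin.
have dep1 x : (sigma - 1) *: f0 x + (mu - 1) *: f1 x = 0.
  apply/rowP => i; rewrite !mxE.
  have := order_coord_jet i x lin (ltnSn 1).
  rewrite endoD endoN jetDx jetN err0 sub0r => /eqP; rewrite oppr_eq0 => /eqP.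
  rewrite endoD jetDx !endoZ !jetZ => <-.
  by rewrite -[RHS]/(_ * X (coord_jet i) 1%N x + _ * Y (coord_jet i) 1%N x) !lie_op_coord_jet.
have s1 : sigma = 1.
  apply/eqP; rewrite -subr_eq0; apply: contraT => s1; exfalso.
  apply: (M0 1%N); first by lia.
  by apply: fM1_dependent dep1; case => e _; rewrite e eqxx in s1.
pose delta j := moment (nodes 0 ab) j - moment1 j.
pose q := area N (nodes 0 ab) - area1 N.
have step j : (j <= N.*2)%N -> (forall i, (i < j)%N -> delta i = 0) -> forall x,
    delta j *: fM f0 f1 j x + (if j == N.*2 then q else 0) *: fW f0 f1 N x = 0.
  move=> jN dl x; apply/rowP => i.
  rewrite [LHS]mxE [X in X + _]mxE [X in _ + X]mxE [RHS]mxE.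
  have := err_step N_gt0 F FX FY Wc DX DY EI jN s1 dl; rewrite -/err => st.
  have := order_coord_jet i x st (ltnSn j.+1).
  rewrite endoD endoN jetDx jetN err0 sub0r => /eqP; rewrite oppr_eq0 => /eqP e0.
  rewrite -[RHS]e0.
  rewrite endoD jetDx endoZ jetZ iter_comm_lie_op.
  rewrite -[X in _ = X + _]/(delta j * lie_op n j.+1 (vsmooth_fM j) (coord_jet i) j.+1 x) lie_op_coord_jet //.
  congr (_ + _); case: eqP => [->|_]; last by rewrite mul0r.
  rewrite comm_lie_op_fW // endoZ jetZ.
  by rewrite -[RHS]/(q * lie_op n n (vsmooth_fW N) (coord_jet i) n x) lie_op_coord_jet.
have low j : (j < N.*2)%N -> delta j = 0.
  have [l] := ubnP j; elim: l j => // l IH j; rewrite ltnS => jl jN.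
  have := step j (ltnW jN) (fun i ij => IH i (leq_trans ij jl) (ltn_trans ij jN)).
  rewrite ltn_eqF // => z; apply/eqP; apply: contraT => dj; exfalso.
  apply: (M0 j (ltnW jN)) => x; apply: (scalerI dj).
  by have := z x; rewrite scale0r addr0 scaler0.
have top := step N.*2 (leqnn _) low; rewrite eqxx in top.
have [d2 q0] : delta N.*2 = 0 /\ q = 0.
  have [//|ne] := pselect (delta N.*2 = 0 /\ q = 0).
  exfalso; apply: indep; exists (delta N.*2), q; split=> //.
  by case=> e1 e2; apply: ne.
apply: (no_positive_quadrature N_gt0 ab0 s1) => [j jN|]; apply/eqP; rewrite -subr_eq0.
  by move: jN; rewrite leq_eqVlt => /orP[/eqP ->|/low /eqP //]; apply/eqP.
by apply/eqP.
Qed.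

End Obstruction.

Theorem theorem1p17 (R : realType) (d : nat) (N : nat) (hN : (1 <= N)%N)
    (f0 f1 : 'rV[R]_d -> 'rV[R]_d) (hf0 : smooth f0) (hf1 : smooth f1)
    (hW : forall j : nat, (1 <= j <= N - 1)%N -> forall x, fW f0 f1 j x = 0)
    (hsplit : exists_splitting_method_of_order f0 f1 (2 * N + 1)%N) :
  linearly_dependent2 (fM f0 f1 (2 * N)%N) (fW f0 f1 N).
Proof.
move: hsplit; rewrite mul2n addn1 => -[k [alpha [beta [_ alpha0 ho]]]].
apply: (splitting_obstruction hN (smooth_vsmooth hf0) (smooth_vsmooth hf1) hW _ ho).
apply/allP => p /(nthP (0, 0)) [i]; rewrite size_zip !size_tuple minnn => ik <-.
by rewrite nth_zip ?size_tuple //= -(tnth_nth _ _ (Ordinal ik)).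
Qed.
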